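(* Let $(\mathcal{A},\varphi)$ be a von Neumann algebra with a faithful, normal, tracial state, let $X,Y\in\mathcal{A}$ be free, self-adjoint and bounded random variables, let $\mu$ be the distribution of $X$, and let $f$ be a bounded complex-valued Borel function on the spectrum of $X$ with $f(X)\ne0$. Let $\delta$ be the unique function on $\mathbb{C}^+$ such that $$E_\varphi\bigl[(z-X-f(X)Yf^*(X))^{-1}\mid X\bigr]=\bigl(z-X-\delta(z)f(X)f^*(X)\bigr)^{-1},\qquad z\in\mathbb{C}^+.$$ Then for $z\in\mathbb{C}^+$ $$G_{X+f(X)Yf^*(X)}(z)=\int_{\mathbb{R}}\frac{1}{z-x-\delta(z)|f(x)|^2}\,d\mu(x).$$
   Context: $\mathbb{C}^+$ is the open upper half-plane. The distribution $\mu$ of $X=X^*$ is the probability measure on $\mathbb{R}$ with $\int x^n\,d\mu(x)=\varphi(X^n)$ for all $n$. For self-adjoint $U$, $G_U(z)=\varphi((z-U)^{-1})$ is its Cauchy transform. $f(X)$ is defined by Borel functional calculus and $f^*(X)=f(X)^*$. $E_\varphi[\,\cdot\mid X]$ is the unique $\varphi$-preserving conditional expectation onto the von Neumann subalgebra generated by $X$; the function $\delta$ exists and is unique (it is the subordination function for $X+f(X)Yf^*(X)$). *)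

(* Defs.v *)
From HB Require Import structures.
From mathcomp Require Import all_boot all_order all_algebra.
From mathcomp Require Import complex.
From mathcomp Require Import all_classical all_reals all_analysis.

Set Implicit Arguments.
Unset Strict Implicit.
Unset Printing Implicit Defensive.

Import Order.TTheory GRing.Theory Num.Theory.
Import numFieldNormedType.Exports.

Local Open Scope classical_set_scope.
Local Open Scope ring_scope.
Local Open Scope complex_scope.

Structure hilbertSpace (R : realType) := HilbertSpace {
  hs_carrier :> completeNormedModType R[i] ;
  (* linear in the first argument, conjugate-linear in the second *)
  inner : {dot hs_carrier for (@Num.conj R[i])} ;
  inner_norm : forall x : hs_carrier, `|x| ^+ 2 = inner x x }.

Section Operators.
Context {R : realType} {H : hilbertSpace R}.

Definition bounded_operator (T : H -> H) : Prop :=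
  linear T /\ exists M : R[i], forall x, `|T x| <= M * `|x|.

Definition adjoint_operators (T S : H -> H) : Prop :=
  forall x y, inner H (T x) y = inner H x (S y).

Definition commutant (S : set (H -> H)) : set (H -> H) :=
  [set T | bounded_operator T /\ forall U, S U -> T \o U = U \o T].

(* Such a set is automatically a unital *-subalgebra of B(H). *)
Definition von_neumann_operators (S : set (H -> H)) : Prop :=
  (forall T, S T -> exists2 T', S T' & adjoint_operators T T') /\
  commutant (commutant S) = S.

End Operators.

(* A von Neumann algebra is given as an abstract algebra A together with an
   injective unital *-representation on a Hilbert space whose range equals its
   own bicommutant.  The unitAlgType structure only makes the inverse of
   invertible elements available: it exists classically on every algebra, and
   x^-1 is meaningful only if x \is a GRing.unit. *)
Structure vonNeumannAlgebra (R : realType) := VonNeumannAlgebra {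
  vn_alg :> unitAlgType R[i] ;
  vn_space : hilbertSpace R ;
  star : vn_alg -> vn_alg ;
  vn_rep : vn_alg -> vn_space -> vn_space ;
  vn_rep_linear : forall (c : R[i]) (a b : vn_alg) (x : vn_space),
    vn_rep (c *: a + b) x = c *: vn_rep a x + vn_rep b x ;
  vn_rep_one : vn_rep 1 = id ;
  vn_rep_mul : forall a b : vn_alg, vn_rep (a * b) = vn_rep a \o vn_rep b ;
  vn_rep_star : forall a : vn_alg,
    adjoint_operators (vn_rep a) (vn_rep (star a)) ;
  vn_rep_inj : injective vn_rep ;
  vn_rep_range : von_neumann_operators (range vn_rep) }.

Section VonNeumann.
Context {R : realType} {A : vonNeumannAlgebra R}.
Implicit Types (a b X Y : A) (phi : {scalar A}) (B : set A).

Definition selfadjoint a : Prop := star a = a.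

Definition vn_nonneg a : Prop :=
  forall x : vn_space A, 0 <= inner (vn_space A) (vn_rep a x) x.

Definition vn_le a b : Prop := vn_nonneg (b - a).

Definition vn_lub (D : set A) a : Prop :=
  (forall d, D d -> vn_le d a) /\
  (forall b, (forall d, D d -> vn_le d b) -> vn_le a b).

Definition vn_directed (D : set A) : Prop :=
  D !=set0 /\
  forall c d, D c -> D d -> exists2 e, D e & vn_le c e /\ vn_le d e.

Definition state phi : Prop :=
  phi 1 = 1 /\ forall a, 0 <= phi (star a * a).

Definition faithful phi : Prop := forall a, phi (star a * a) = 0 -> a = 0.

Definition tracial phi : Prop := forall a b, phi (a * b) = phi (b * a).

Definition normal phi : Prop :=
  forall (D : set A) a, vn_directed D -> (forall d, D d -> selfadjoint d) ->
    selfadjoint a -> vn_lub D a -> supremums (phi @` D) (phi a).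

Definition vn_subalgebra B : Prop := von_neumann_operators (@vn_rep R A @` B).

Definition vn_generated (S : set A) : set A :=
  \bigcap_(B in [set B | vn_subalgebra B /\ S `<=` B]) B.

(* In an alternating word the tag true stands for B1 and false for B2. *)
Definition free_subsets phi (B1 B2 : set A) : Prop :=
  forall s : seq (bool * A), s != [::] ->
    sorted (fun u v => u.1 != v.1) s ->
    (forall u, u \in s -> (if u.1 then B1 else B2) u.2 /\ phi u.2 = 0) ->
    phi (\prod_(u <- s) u.2) = 0.

(* For self-adjoint X, the polynomials in X form the unital *-algebra
   generated by X. *)
Definition free_variables phi X Y : Prop :=
  free_subsets phi (range (horner_alg X)) (range (horner_alg Y)).

Definition conditional_expectation phi B (E : {linear A -> A}) : Prop :=
  [/\ forall a, B (E a),
      forall b, B b -> E b = b,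
      forall b a c, B b -> B c -> E (b * a * c) = b * E a * c,
      forall a, vn_nonneg a -> vn_nonneg (E a) &
      forall a, phi (E a) = phi a].

Definition cauchy_transform phi (U : A) (z : R[i]) : R[i] :=
  phi ((z%:A - U)^-1).

Definition spectrum X : set R[i] :=
  [set z | ~ (z%:A - X \is a GRing.unit)].

(* The spectrum of a self-adjoint element is contained in the real line. *)
Definition real_spectrum X : set R := [set x | spectrum X x%:C].

End VonNeumann.

Section Borel.
Context {R : realType}.
Implicit Types (D : set R) (f g : R -> R[i]).

Definition borel_on D f : Prop :=
  measurable_fun D (fun x => complex.Re (f x)) /\ measurable_fun D (fun x => complex.Im (f x)).

Definition bounded_by D f (M : R[i]) : Prop := forall x, D x -> `|f x| <= M.

Definition bounded_borel D f : Prop :=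
  borel_on D f /\ exists M, bounded_by D f M.

Definition extend0 D f : R -> R[i] := patch (fun=> 0) D f.

(* cintegral is meaningful only together with cintegrable: Rintegral takes a
   junk value when the integral does not exist in R. *)
Definition cintegrable (mu : {measure set (measurableTypeR R) -> \bar R}) f : Prop :=
  mu.-integrable setT (fun x => (complex.Re (f x))%:E) /\
  mu.-integrable setT (fun x => (complex.Im (f x))%:E).

Definition cintegral (mu : {measure set (measurableTypeR R) -> \bar R}) f : R[i] :=
  Rintegral mu setT (fun x => complex.Re (f x)) +i*
  Rintegral mu setT (fun x => complex.Im (f x)).

End Borel.

Section Calculus.
Context {R : realType} {A : vonNeumannAlgebra R}.

Definition is_distribution (phi : {scalar A}) (X : A)
    (mu : probability (measurableTypeR R) R) : Prop :=
  forall n, cintegrable mu (fun x => x%:C ^+ n) /\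
    cintegral mu (fun x => x%:C ^+ n) = phi (X ^+ n).

(* The Borel functional calculus f |-> f(X) of a self-adjoint X, as the unique
   unital *-homomorphism on bounded Borel functions on the spectrum that maps
   the identity function to X and bounded pointwise limits of sequences to
   strong limits.  Only the values on the spectrum matter (take a constant
   sequence of functions). *)
Definition borel_functional_calculus (X : A) (F : (R -> R[i]) -> A) : Prop :=
  let D := real_spectrum X in
  [/\ F (fun=> 1) = 1 /\ F (fun x => x%:C) = X,
      forall c f g, bounded_borel D f -> bounded_borel D g ->
        F (fun x => c * f x + g x) = c *: F f + F g,
      forall f g, bounded_borel D f -> bounded_borel D g ->
        F (fun x => f x * g x) = F f * F g,
      forall f, bounded_borel D f -> F (fun x => (f x)^*) = star (F f) &
      forall (f_ : nat -> R -> R[i]) f M,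
        (forall n, borel_on D (f_ n) /\ bounded_by D (f_ n) M) ->
        bounded_borel D f ->
        (forall x, D x -> (f_ n x : R[i]^o) @[n --> \oo] --> (f x : R[i]^o)) ->
        forall v : vn_space A,
          vn_rep (F (f_ n)) v @[n --> \oo] --> vn_rep (F f) v].

End Calculus.

(* Main.v *)
Require Import Defs.
From HB Require Import structures.
From mathcomp Require Import all_boot all_order all_algebra.
From mathcomp Require Import complex ring lra.
From mathcomp Require Import all_classical all_reals all_analysis.
From mathcomp Require Import measurable_realfun.

Import Order.TTheory GRing.Theory Num.Theory.
Import numFieldNormedType.Exports.

Local Open Scope classical_set_scope.
Local Open Scope ring_scope.
Local Open Scope complex_scope.

(** Since [E] preserves [phi], the Cauchy transform equals [phi (g(X)^-1)] for
    the bounded Borel function [g x = z - x - delta z |f x|^2], and the proof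
    reduces to [phi (k(X)) = \int k dmu] for bounded Borel [k] together with
    [g(X)^-1 = (1/g)(X)].  Normality of [phi] and the strong continuity of the
    calculus make [S |-> phi (1_S(X))] a probability measure on the spectrum,
    which is compact (Neumann series); it has the moments of [mu], and compactly
    supported measures are determined by their moments.  Finally, invertibility
    of [g(X)] forces [1_{|g| < eps}(X) = 0] for some [eps > 0], so [1/g] is
    mu-essentially bounded. *)

(** * Positive functionals on bounded Borel functions *)

(** The hypotheses speak of different things: [borel_functional_calculus] gives algebraic rules and
    strong limits of bounded sequences, [normal] concerns least upper bounds in the operator order,
    and [is_distribution] knows only moments. Indicators are the common ground. For increasing sets
    the projections [1_S(X)] converge strongly, and since [<P v, v> = |P v|^2] for a projection, the
    strong limit is also the least upper bound. So the spectral measure is built from monotone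
    continuity on sets alone, and a halving argument carries equalities from indicators to bounded
    functions. No support is prescribed for [mu]; its compactness is extracted from the growth of
    the even moments. Only the defining property of [delta z] is at hand, which gives no pointwise
    lower bound on [|g|]. The gap has to come from the operator [g(X)], and the denominator may
    vanish on a [mu]-null set, where the integrand has the value 0. *)

Definition bounded_measurable {R : realType} (h : R -> R) :=
  measurable_fun [set: R] h /\ exists M : R, forall x, `|h x| <= M.

Section BoundedMeasurable.
Context {R : realType}.
Implicit Types (h g : R -> R) (S : set R).

Lemma bounded_measurable_indic S : measurable S -> bounded_measurable \1_S.
Proof.
move=> mS; split; first exact: measurable_indic.
by exists 1 => x; rewrite indicE ger0_norm ?ler0n// lern1 leq_b1.
Qed.

Lemma bounded_measurable_cst c : bounded_measurable (cst c : R -> R).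
Proof. by split; [exact: measurable_cst|exists `|c|]. Qed.

Lemma bounded_measurable_lin c h g : bounded_measurable h ->
  bounded_measurable g -> bounded_measurable (fun x => c * h x + g x).
Proof.
move=> [mh [M hM]] [mg [N gN]]; split.
  by apply: measurable_funD => //; apply: measurable_funM.
exists (`|c| * M + N) => x; rewrite (le_trans (ler_normD _ _))// lerD//.
by rewrite normrM ler_wpM2l.
Qed.

Lemma bounded_measurableM h g : bounded_measurable h ->
  bounded_measurable g -> bounded_measurable (fun x => h x * g x).
Proof.
move=> [mh [M hM]] [mg [N gN]]; split; first exact: measurable_funM.
by exists (M * N) => x; rewrite normrM ler_pM.
Qed.

Lemma bounded_measurable_integrable
    (nu : probability (measurableTypeR R) R) h :
  bounded_measurable h -> nu.-integrable setT (EFin \o h).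
Proof.
move=> [mh [M hM]]; apply: measurable_bounded_integrable => //.
- by rewrite [X in (X < _)%E](_ : _ = 1%E) ?ltry//; exact: probability_setT.
- exists M; split => [|y My x _]; first exact: num_real.
  exact: le_trans (hM x) (ltW My).
Qed.

Lemma Rintegral_indic (nu : probability (measurableTypeR R) R) S :
  measurable S -> Rintegral nu setT \1_S = fine (nu S).
Proof. by move=> mS; rewrite /Rintegral integral_indic// setIT. Qed.

End BoundedMeasurable.

Section PositiveFunctional.
Context {R : realType}.
Variable J : (R -> R) -> R.
Hypothesis J_lin : forall c h g, bounded_measurable h -> bounded_measurable g ->
  J (fun x => c * h x + g x) = c * J h + J g.
Hypothesis J_ge0 : forall h, bounded_measurable h ->
  (forall x, 0 <= h x) -> 0 <= J h.
Hypothesis J_one : J (cst 1) = 1.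

Lemma functional_mono h g : bounded_measurable h -> bounded_measurable g ->
  (forall x, h x <= g x) -> J h <= J g.
Proof.
move=> bh bg hg.
have -> : g = (fun x => 1 * (-1 * h x + g x) + h x).
  by apply/funext => x; ring.
rewrite J_lin ?mul1r//; last exact: bounded_measurable_lin.
rewrite lerDr J_ge0//; first exact: bounded_measurable_lin.
by move=> x; rewrite mulN1r addrC subr_ge0.
Qed.

Lemma functional0 : J (cst 0) = 0.
Proof.
have := J_lin (-1) _ _ (bounded_measurable_cst 0) (bounded_measurable_cst 0).
rewrite mulN1r addNr => J0; rewrite -[RHS]J0; congr J; apply/funext => x /=; ring.
Qed.

Lemma functionalD h g : bounded_measurable h -> bounded_measurable g ->
  J (h \+ g) = J h + J g.
Proof.
move=> bh bg; rewrite -[J h]mul1r -J_lin//; congr J; apply/funext => x /=; ring.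
Qed.

Lemma functionalZ c h : bounded_measurable h -> J (fun x => c * h x) = c * J h.
Proof.
move=> bh; rewrite -[RHS]addr0 -functional0 -J_lin//.
  by congr J; apply/funext => x /=; rewrite addr0.
exact: bounded_measurable_cst.
Qed.

End PositiveFunctional.

(* Any [h] with values in [0, 1] satisfies [2 h = 1_{h >= 1/2} + h'] with [h']
   again with values in [0, 1]; so two positive functionals that agree on
   indicators differ on [h] by half of their difference on [h']. *)
Lemma positive_functional_unique {R : realType} (J K : (R -> R) -> R) :
  (forall c h g, bounded_measurable h -> bounded_measurable g ->
    J (fun x => c * h x + g x) = c * J h + J g) ->
  (forall h, bounded_measurable h -> (forall x, 0 <= h x) -> 0 <= J h) ->
  (forall c h g, bounded_measurable h -> bounded_measurable g ->
    K (fun x => c * h x + g x) = c * K h + K g) ->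
  (forall h, bounded_measurable h -> (forall x, 0 <= h x) -> 0 <= K h) ->
  J (cst 1) = 1 -> K (cst 1) = 1 ->
  (forall S, measurable S -> J \1_S = K \1_S) ->
  forall h, bounded_measurable h -> J h = K h.
Proof.
move=> JL J0 KL K0 J1 K1 JK.
have unit_int n h : bounded_measurable h -> (forall x, 0 <= h x <= 1) ->
    `|J h - K h| <= (2 ^+ n)^-1.
  elim: n h => [|n IH] h bh h01.
    have [/andP[? ?] /andP[? ?]] : (0 <= J h <= 1) /\ (0 <= K h <= 1).
      have b1 := bounded_measurable_cst (1 : R).
      split; apply/andP; split.
      - by apply: J0 => // x; case/andP: (h01 x).
      - by rewrite -J1; apply: functional_mono => // x; case/andP: (h01 x).
      - by apply: K0 => // x; case/andP: (h01 x).
      - by rewrite -K1; apply: functional_mono => // x; case/andP: (h01 x).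
    by rewrite expr0 invr1 ler_norml; lra.
  pose S := [set x | 2^-1 <= h x].
  have mS : measurable S.
    have := bh.1 measurableT `[2^-1, +oo[%classic (measurable_itv _).
    rewrite setTI; congr measurable; apply/seteqP.
    by split => x /=; rewrite in_itv/= andbT.
  pose h' x := 2 * h x + - 1 * \1_S x.
  have bS := bounded_measurable_indic _ mS.
  have bh' : bounded_measurable h'.
    have -> : h' = (fun x => -1 * \1_S x + (1 * h x + h x)).
      by apply/funext => x; rewrite /h'; ring.
    by do 2 apply: bounded_measurable_lin => //.
  have h'01 x : 0 <= h' x <= 1.
    rewrite /h' indicE; case/andP: (h01 x) => h0 h1.
    case: (boolP (x \in S)) => [/set_mem /= xS|/negP xS].
      have {}xS : 2^-1 <= h x := xS.
      by rewrite mulr1n; apply/andP; lra.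
    have /negP : ~ (2^-1 <= h x) by move=> xS'; apply: xS; rewrite inE.
    by rewrite -ltNge mulr0n => ?; apply/andP; lra.
  have -> : h = (fun x => 2^-1 * h' x + (2^-1 * \1_S x)).
    by apply/funext => x; rewrite /h'; field.
  have bS2 : bounded_measurable (fun x => 2^-1 * \1_S x : R).
    have := bounded_measurable_lin 2^-1 _ _ bS (bounded_measurable_cst (0 : R)).
    by congr bounded_measurable; apply/funext => x /=; rewrite addr0.
  rewrite JL// KL// (functionalZ _ JL)// (functionalZ _ KL)// JK//.
  rewrite opprD addrACA subrr addr0 -mulrBr normrM gtr0_norm ?invr_gt0//.
  by rewrite exprS invfM ler_wpM2l ?invr_ge0//; exact: IH.
move=> h bh; have [mh [M hM]] := bh.
have [M0 hM'] : 0 < `|M| + 1 /\ forall x, `|h x| <= `|M| + 1.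
  split; first by rewrite ltr_pwDr.
  by move=> x; rewrite (le_trans (hM x))// (le_trans (ler_norm _))// lerDl.
move: (`|M| + 1) M0 hM' => N N0 hN.
(* The affine map from [[-N, N]] onto [[0, 1]]; adding 1 to [|M|] made [N] positive. *)
pose g x := (2 * N)^-1 * h x + cst 2^-1 x.
have b1 := bounded_measurable_cst (1 : R).
have bg : bounded_measurable g.
  by apply: bounded_measurable_lin => //; exact: bounded_measurable_cst.
have g01 x : 0 <= g x <= 1.
  have := hN x; rewrite ler_norml => /andP[h1 h2].
  have E : g x * (2 * N) = h x + N by rewrite /g /=; field; lra.
  have N2 : 0 < 2 * N by lra.
  by rewrite -(ler_pM2r N2) -(ler_pM2r N2 (g x)) E; apply/andP; lra.
have -> : h = (fun x => (2 * N) * g x + (- N * cst 1 x)).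
  by apply/funext => x; rewrite /g /=; field; lra.
have bc : bounded_measurable (fun x => - N * cst 1 x : R).
  exact: (bounded_measurable_cst (- N * 1)).
rewrite JL// KL// (functionalZ _ JL)// (functionalZ _ KL)// J1 K1.
congr (_ * _ + _); apply/eqP; rewrite -subr_eq0 -normr_le0.
have : (2 ^- n : R) @[n --> \oo] --> (0 : R).
  under eq_fun do rewrite -exprVn.
  by apply: cvg_expr; rewrite ger0_norm ?invr_ge0// invf_lt1// ltr1n.
move=> cv.
have := @limr_ge _ _ _ _ `|J g - K g| _ (cvgP _ cv).
rewrite (cvg_lim _ cv)//; apply; apply: nearW => n; exact: unit_int.
Qed.

(** * Representation of positive functionals by probability measures *)

Section RieszMarkov.
Context {R : realType}.
Variable J : (R -> R) -> R.
Hypothesis J_lin : forall c h g, bounded_measurable h -> bounded_measurable g ->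
  J (fun x => c * h x + g x) = c * J h + J g.
Hypothesis J_ge0 : forall h, bounded_measurable h ->
  (forall x, 0 <= h x) -> 0 <= J h.
Hypothesis J_one : J (cst 1) = 1.
Hypothesis J_cont : forall S : nat -> set R, (forall n, measurable (S n)) ->
  (forall m n, (m <= n)%N -> S m `<=` S n) ->
  J \1_(S n) @[n --> \oo] --> J \1_(\bigcup_n S n).

(** Positivity of [J] says nothing about non-measurable sets, but [nu] must be nonnegative on every
    set; the absolute value ensures this and changes nothing on measurable sets. *)
Let nu (S : set (measurableTypeR R)) : \bar R := `|J \1_S|%:E.

Let nuE S : measurable S -> nu S = (J \1_S)%:E.
Proof.
move=> mS; rewrite /nu ger0_norm// J_ge0//; first exact: bounded_measurable_indic.
Qed.

Let nu0 : nu set0 = 0%E.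
Proof. by rewrite /nu indic0 functional0// normr0. Qed.

Let nu_ge0 S : (0 <= nu S)%E.
Proof. by rewrite lee_fin. Qed.

(** By disjointness and linearity, the partial sums are the values of [J] at the indicators of the
    finite unions [S n]. These unions increase to the whole union, so [J_cont] applies. *)
Let nu_sigma_additive : semi_sigma_additive nu.
Proof.
move=> F mF tF mU.
pose S n := \big[setU/set0]_(i < n) F i.
have mS n : measurable (S n) by apply: bigsetU_measurable.
have sumE n : (\sum_(0 <= i < n) nu (F i))%E = (J \1_(S n))%:E.
  elim: n => [|n IH].
    by rewrite big_geq// /S big_ord0 indic0 functional0.
  rewrite big_nat_recr//= IH nuE// -EFinD; congr EFin.
  have -> : \1_(S n.+1) = \1_(S n) \+ \1_(F n) :> (R -> R).
    apply/funext => x; rewrite /S big_ord_recr/= -/(S n) !indicE in_setU.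
    case: (boolP (x \in S n)) => [xS|_]; last by rewrite add0r.
    case: (boolP (x \in F n)) => [xF|_]; last by rewrite addr0.
    exfalso; move/set_mem: xS; rewrite /S -bigcup_mkord => -[i /= ltin xFi].
    have := tF n i I I; rewrite -[_ = _]/((n : nat) = i) => H.
    have : n = i by apply: H; exists x; split => //; exact: set_mem.
    by move=> E; rewrite -E ltnn in ltin.
  apply/esym/(functionalD J J_lin); first exact: (bounded_measurable_indic _ (mS n)).
  exact: (bounded_measurable_indic _ (mF n)).
rewrite (_ : (fun n => _) = (fun n => (J \1_(S n))%:E)); last first.
  by apply/funext => n; exact: sumE.
rewrite nuE//; apply: cvg_EFin; first by apply: nearW.
rewrite (_ : \bigcup_n F n = \bigcup_n S n); last first.
  apply/seteqP; split => [x [i _ Fi]|x [n _]].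
    by exists i.+1 => //; rewrite /S -bigcup_mkord; exists i => /=.
  by rewrite /S -bigcup_mkord => -[i _ Fi]; exists i.
apply: J_cont => // m n mn x; rewrite /S -!bigcup_mkord => -[i /= im Fi].
by exists i => //=; exact: leq_trans im mn.
Qed.

HB.instance Definition _ := isMeasure.Build _ _ _ nu nu0 nu_ge0 nu_sigma_additive.

Let nuT : nu setT = 1%E.
Proof. by rewrite nuE// indicT J_one. Qed.

HB.instance Definition _ := Measure_isProbability.Build _ _ _ nu nuT.

(** [J] and integration against [nu] are both positive, linear and normalized, and they agree on
    indicators by the choice of [nu]; [positive_functional_unique] does the rest. *)
Lemma positive_functional_integral :
  exists nu : probability (measurableTypeR R) R,
    forall h, bounded_measurable h -> J h = Rintegral nu setT h.
Proof.
exists nu; apply: positive_functional_unique => //.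
- move=> c h g bh bg.
  rewrite RintegralD//; last exact: bounded_measurable_integrable.
    by rewrite RintegralZl//; exact: bounded_measurable_integrable.
  have [mh [M hM]] := bh.
  apply: (bounded_measurable_integrable _ (fun x => c * h x)).
  have := bounded_measurable_lin c _ _ bh (bounded_measurable_cst (0 : R)).
  by congr bounded_measurable; apply/funext => x /=; rewrite addr0.
- by move=> h bh h0; apply: Rintegral_ge0.
- by rewrite Rintegral_cst// mul1r [X in fine X](_ : _ = 1%E)//; exact: nuT.
- move=> S mS; rewrite Rintegral_indic// [X in fine X](_ : _ = (J \1_S)%:E)//.
  exact: nuE.
Qed.

End RieszMarkov.
(** * Uniqueness in the moment problem with compact support *)

Section NullSets.
Context {R : realType} (nu : probability (measurableTypeR R) R).
Variables (K : set R).
Hypotheses (mK : measurable K) (nuK : nu (~` K) = 0%E).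
Implicit Types (h g : R -> R).

Let ae_eq_supp h g : (forall x, K x -> h x = g x) ->
  ae_eq nu setT (EFin \o h) (EFin \o g).
Proof.
move=> hg; exists (~` K); split => //; first exact: measurableC.
by move=> x /= H Kx; apply: H => _; rewrite hg.
Qed.

(** Used to exchange a function that is unbounded on the line, such as a power, for its truncation
    to a set of full measure. *)
Lemma supp_Rintegral h g : measurable_fun [set: R] h ->
  measurable_fun [set: R] g -> (forall x, K x -> h x = g x) ->
  Rintegral nu setT h = Rintegral nu setT g.
Proof.
move=> mh mg hg; rewrite /Rintegral; congr fine.
by apply: ae_eq_integral => //;
  [exact/measurable_EFinP|exact/measurable_EFinP|exact: ae_eq_supp].
Qed.

Lemma supp_integrable h g : measurable_fun [set: R] h ->
  measurable_fun [set: R] g -> (forall x, K x -> h x = g x) ->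
  nu.-integrable setT (EFin \o g) -> nu.-integrable setT (EFin \o h).
Proof.
move=> mh mg hg /integrableP[_ ig]; apply/integrableP; split.
  exact/measurable_EFinP.
rewrite (_ : (\int[nu]_x _)%E = (\int[nu]_x `|(EFin \o g) x|)%E)//.
apply: ae_eq_integral => //.
- by apply: measurableT_comp => //; exact/measurable_EFinP.
- by apply: measurableT_comp => //; exact/measurable_EFinP.
have := @ae_eq_supp (fun x => `|h x|) (fun x => `|g x|).
by apply => x Kx; rewrite hg.
Qed.

End NullSets.

Lemma bounded_convergence {R : realType}
    (nu : probability (measurableTypeR R) R) (g_ : nat -> R -> R) (g : R -> R) :
  (forall n, measurable_fun [set: R] (g_ n)) -> measurable_fun [set: R] g ->
  (forall n x, `|g_ n x| <= 1) ->
  (forall x, g_ n x @[n --> \oo] --> g x) ->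
  Rintegral nu setT (g_ n) @[n --> \oo] --> Rintegral nu setT g.
Proof.
move=> mg_ mg bg cg.
have [|||||ig _ cvi] := @dominated_convergence _ _ _ nu setT measurableT
  (fun n => EFin \o g_ n) (EFin \o g) (cst 1%E).
- by move=> n; apply/measurable_EFinP; exact: mg_.
- by apply/measurable_EFinP; exact: mg.
- by apply: aeW => x _; apply: cvg_EFin; [exact: nearW|exact: cg].
- exact: (bounded_measurable_integrable nu _ (bounded_measurable_cst 1)).
- by apply: aeW => x n _ /=; rewrite lee_fin.
apply: fine_cvg; rewrite fineK//.
exact: integrable_fin_num.
Qed.

(* By Bernoulli's inequality the behaviour of [step_approx n u] is governed by
   [4 ^ n u ^ (2 n) / n = (2 u) ^ (2 n) / n] (with [n.+1] for [n]), which tends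
   to 0 if [u <= 1/2] and to infinity if [u > 1/2]: these polynomials converge
   boundedly on [0, 1] to the indicator of [0, 1/2].  The division by [n] makes
   the limit at [u = 1/2] equal to 1. *)
Definition step_approx {R : realType} (n : nat) (u : R) : R :=
  (1 - n.+1%:R^-1 * u ^+ (2 * n.+1)) ^+ (4 ^ n.+1).

Section StepApprox.
Context {R : realType}.
Implicit Types (u t : R).

Let base_bound n u : 0 <= u <= 1 -> 0 <= n.+1%:R^-1 * u ^+ (2 * n.+1) <= 1.
Proof.
case/andP=> u0 u1; rewrite mulr_ge0 ?invr_ge0 ?exprn_ge0//=.
by rewrite mulr_ile1 ?invr_ge0 ?exprn_ge0 ?exprn_ile1// invf_le1 ?ler1n// ltr0n.
Qed.

Lemma step_approx_bound n u : 0 <= u <= 1 -> 0 <= step_approx n u <= 1.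
Proof.
move=> /(base_bound n)/andP[b0 b1].
by rewrite exprn_ge0 ?exprn_ile1 ?subr_ge0// gerBl.
Qed.

Let bernoulli_lower m t : 0 <= t <= 1 -> 1 - m%:R * t <= (1 - t) ^+ m.
Proof.
case/andP=> t0 t1; elim: m => [|m IH]; first by rewrite mul0r subr0.
rewrite exprS; apply: (@le_trans _ _ ((1 - t) * (1 - m%:R * t))).
  rewrite -natr1; have : 0 <= m%:R * t * t by rewrite !mulr_ge0.
  by nra.
by rewrite ler_wpM2l// subr_ge0.
Qed.

Let bernoulli_upper m t : 0 <= t <= 1 -> (1 - t) ^+ m * (1 + m%:R * t) <= 1.
Proof.
case/andP=> t0 t1; elim: m => [|m IH]; first by rewrite mul0r addr0 mul1r.
apply: le_trans IH; rewrite exprSr -mulrA ler_wpM2l ?exprn_ge0 ?subr_ge0//.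
rewrite -natr1; have : 0 <= m%:R * t * t by rewrite !mulr_ge0.
by have := mulr_ge0 t0 t0; nra.
Qed.

Lemma step_approx_rate u : 0 <= u <= 1 ->
  exists C, forall n, `|step_approx n u - (u <= 2^-1)%R%:R| <= C * n.+1%:R^-1.
Proof.
move=> u01; have /andP[u0 u1] := u01.
have powE n : (4 ^ n.+1)%:R * (n.+1%:R^-1 * u ^+ (2 * n.+1)) =
    n.+1%:R^-1 * ((2 * u) ^+ n.+1) ^+ 2.
  have -> : ((2 * u) ^+ n.+1) ^+ 2 = (4 * u ^+ 2) ^+ n.+1.
    by rewrite -exprM mulnC exprM; congr (_ ^+ _); ring.
  by rewrite natrX mulrCA exprM -exprMn.
have [u2|u2] := leP u 2^-1.
  exists 1 => n; have /andP[q0 q1] := step_approx_bound n u u01.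
  have := bernoulli_lower (4 ^ n.+1) _ (base_bound n u u01).
  rewrite -/(step_approx n u) powE => lb.
  rewrite mul1r distrC ger0_norm ?subr_ge0// lerBlDr -lerBlDl.
  apply: le_trans lb; rewrite lerB// ler_piMr ?invr_ge0//.
  by rewrite !exprn_ile1// ?exprn_ge0 ?mulr_ge0//; lra.
(* Since [2 u = 1 + d], Bernoulli gives [(2 u)^(n+1) >= (n+1) d]; the square divided by [n+1] is at
   least [(n+1) d^2], whence the constant [d^-2]. It blows up as [u] decreases to 1/2, so the rate
   is only pointwise in [u]. *)
pose d := 2 * u - 1.
have d0 : 0 < d by rewrite /d; lra.
exists (d ^- 2) => n; have /andP[q0 q1] := step_approx_bound n u u01.
rewrite subr0 ger0_norm//.
have := bernoulli_upper (4 ^ n.+1) _ (base_bound n u u01).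
rewrite -/(step_approx n u) powE => ub.
have nd : 1 + n.+1%:R * d <= (2 * u) ^+ n.+1.
  have -> : 2 * u = 1 + d by rewrite /d; ring.
  elim: n.+1 => [|m IH]; first by rewrite mul0r addr0.
  rewrite exprS; apply: (@le_trans _ _ ((1 + d) * (1 + m%:R * d))).
    have md : 0 <= m%:R * d * d by rewrite !mulr_ge0// ltW.
    by rewrite -natr1; nra.
  by rewrite ler_wpM2l// addr_ge0// ltW.
have n0 : 0 < n.+1%:R :> R by rewrite ltr0n.
have nd2 : n.+1%:R * d ^+ 2 <= n.+1%:R^-1 * ((2 * u) ^+ n.+1) ^+ 2.
  rewrite ler_pdivlMl// mulrA -expr2 -exprMn.
  by rewrite lerXn2r ?nnegrE ?mulr_ge0 ?exprn_ge0 ?ltW//; lra.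
rewrite -invfM -[leRHS]mul1r ler_pdivlMr ?mulr_gt0 ?exprn_gt0//; apply: le_trans ub.
by rewrite ler_wpM2l// [d ^+ 2 * _]mulrC (le_trans nd2)// lerDr.
Qed.

End StepApprox.

Section Moments.
Context {R : realType}.
Implicit Types (mu nu : probability (measurableTypeR R) R).

Let pow_bounded n (r : R) :
  bounded_measurable (fun x => x ^+ n * \1_(`[-r, r]%classic) x).
Proof.
split; first by apply: measurable_funM => //; exact: measurable_indic.
exists (`|r| ^+ n) => x; rewrite indicE.
have [/set_mem/=|_] := boolP (x \in _); last first.
  by rewrite mulr0 normr0 exprn_ge0.
rewrite in_itv/= mulr1 normrX -ler_norml => xr.
by rewrite lerXn2r ?nnegrE// (le_trans xr)// ler_norm.
Qed.

Lemma supp_integrable_pow nu (r : R) n : nu (~` `[-r, r]) = 0%E ->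
  nu.-integrable setT (EFin \o (fun x : R => x ^+ n)).
Proof.
move=> nur; apply: (supp_integrable nu `[-r, r]%classic _ _ _
  (fun x => x ^+ n * \1_(`[-r, r]%classic) x)) => //.
- exact: (pow_bounded n r).1.
- by move=> x xr; rewrite indicE mem_set// mulr1.
- exact/bounded_measurable_integrable/pow_bounded.
Qed.

Let moments_poly mu nu (a : nat -> R) (m : nat) :
  (forall n, mu.-integrable setT (EFin \o (fun x : R => x ^+ n))) ->
  (forall n, nu.-integrable setT (EFin \o (fun x : R => x ^+ n))) ->
  (forall n, Rintegral mu setT (fun x => x ^+ n) =
             Rintegral nu setT (fun x => x ^+ n)) ->
  Rintegral mu setT (fun x => \sum_(i < m) a i * x ^+ i) =
  Rintegral nu setT (fun x => \sum_(i < m) a i * x ^+ i).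
Proof.
move=> imu inu E.
have iZ (P : probability (measurableTypeR R) R) n :
    (forall n, P.-integrable setT (EFin \o (fun x : R => x ^+ n))) ->
    P.-integrable setT (EFin \o (fun x : R => a n * x ^+ n)).
  by move=> iP; exact: (integrableZl measurableT (a n) (iP n)).
have iS (P : probability (measurableTypeR R) R) k :
    (forall n, P.-integrable setT (EFin \o (fun x : R => x ^+ n))) ->
    P.-integrable setT (EFin \o (fun x : R => \sum_(i < k) a i * x ^+ i)).
  move=> iP; rewrite (_ : _ \o _ =
    (fun x : R => (\sum_(i < k) (a i * x ^+ i)%:E)%E)); last first.
    by apply/funext => x /=; rewrite sumEFin.
  by apply: integrable_sum => // i _; exact: iZ.
elim: m => [|m IH].
  have -> : (fun x => \sum_(i < 0) a i * x ^+ i) = cst 0.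
    by apply/funext => x; rewrite big_ord0.
  by rewrite !Rintegral_cst// !mul0r.
have -> : (fun x => \sum_(i < m.+1) a i * x ^+ i) =
    (fun x => \sum_(i < m) a i * x ^+ i + a m * x ^+ m).
  by apply/funext => x; rewrite big_ord_recr.
rewrite !RintegralD//; [|exact: iS|exact: iZ|exact: iS|exact: iZ].
by rewrite !RintegralZl// IH E.
Qed.

(* Markov's inequality for [x ^+ (2 * n)], as [n] tends to infinity. *)
Let supp_of_moments mu nu (r : R) : 0 <= r -> nu (~` `[-r, r]) = 0%E ->
  (forall n, mu.-integrable setT (EFin \o (fun x : R => x ^+ n))) ->
  (forall n, Rintegral mu setT (fun x => x ^+ n) =
             Rintegral nu setT (fun x => x ^+ n)) ->
  mu (~` `[-(r + 1), r + 1]) = 0%E.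
Proof.
move=> r0 nur imu E; set B := ~` _.
have mB : measurable B by exact: measurableC.
have mu_fin : mu B = (fine (mu B))%:E by rewrite fineK// fin_num_measure.
rewrite mu_fin; congr EFin; apply/eqP; rewrite eq_le fine_ge0// andbT.
(* On [B] one has [x^(2n) >= (r+1)^(2n)], while the moment of order [2n], computed with [nu], is at
   most [r^(2n)]. The margin 1 in the radius makes the ratio less than 1. *)
pose q := (r / (r + 1)) ^+ 2.
have r1 : 0 < r + 1 by lra.
have bound n : fine (mu B) <= q ^+ n.
  rewrite /q -exprM expr_div_n ler_pdivlMr ?exprn_gt0//.
  rewrite -Rintegral_indic// mulrC -RintegralZl//; last first.
    exact/bounded_measurable_integrable/bounded_measurable_indic.
  apply: (@le_trans _ _ (Rintegral mu setT (fun x => x ^+ (2 * n)))).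
    apply: le_Rintegral => //.
      apply: bounded_measurable_integrable; apply: bounded_measurableM.
        exact: bounded_measurable_cst.
      exact: bounded_measurable_indic.
    move=> x _; rewrite ?indicE; have [/set_mem/=|_] := boolP (x \in B); last first.
      by rewrite mulr0 exprM exprn_ge0// sqr_ge0.
    move=> /negP; rewrite in_itv/= -ler_norml -ltNge mulr1 => /ltW xr.
    by rewrite !exprM -(real_normK (num_real x)) !lerXn2r ?nnegrE ?exprn_ge0// ltW.
  rewrite E (supp_Rintegral nu `[-r, r]%classic _ _ _
    (fun x => x ^+ (2 * n) * \1_(`[-r, r]%classic) x))//.
  - have -> : r ^+ (2 * n) = Rintegral nu setT (cst (r ^+ (2 * n))).
      by rewrite Rintegral_cst// [X in fine X](_ : _ = 1%E) ?mulr1//;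
        exact: probability_setT.
    apply: le_Rintegral => //.
    + exact/bounded_measurable_integrable/pow_bounded.
    + exact/bounded_measurable_integrable/bounded_measurable_cst.
    move=> x _ /=; rewrite indicE; have [/set_mem/=|_] := boolP (x \in _); last first.
      by rewrite mulr0 exprn_ge0.
    rewrite in_itv/= mulr1 -ler_norml => xr.
    by rewrite !exprM -(real_normK (num_real x)) !lerXn2r ?nnegrE ?exprn_ge0.
  - exact: (pow_bounded _ r).1.
  - by move=> x xr; rewrite indicE mem_set// mulr1.
have q1 : `|q| < 1.
  rewrite ger0_norm ?sqr_ge0// /q expr_lt1// ?divr_ge0// 1?ltW//.
  by rewrite ltr_pdivrMr// mul1r ltrDl.
have cv := cvg_expr q1.
have := @limr_ge _ _ _ _ (fine (mu B)) _ (cvgP _ cv).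
by rewrite (cvg_lim _ cv)//; apply; apply: nearW => n; exact: bound.
Qed.

(** On [[-c, c]] one has [|x - a| <= c + |a|], so the affine map [u] takes values in [[0, 1]] there
    and sends [a] to 1/2. Hence [u x <= 1/2] exactly when [x <= a], and [step_approx n \o u] is a
    polynomial close to the indicator of the half-line. *)
Let half_line mu (c a : R) : 0 < c -> mu (~` `[-c, c]) = 0%E ->
  let u x : R := (2^-1 - a / (2 * (c + `|a|))) + (2 * (c + `|a|))^-1 * x in
  Rintegral mu setT (step_approx n \o u) @[n --> \oo] -->
    fine (mu `]-oo, a]%classic).
Proof.
move=> c0 muc u; set K := `[-c, c]%classic.
have mK : measurable K by exact: measurable_itv.
have mI : measurable `]-oo, a]%classic by exact: measurable_itv.
have k0 : 0 < 2 * (c + `|a|) by have := normr_ge0 a; lra.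
have uE x : u x = 2^-1 + (x - a) / (2 * (c + `|a|)) by rewrite /u; ring.
have u01 x : K x -> 0 <= u x <= 1.
  rewrite /K /= in_itv/= => /andP[x1 x2].
  have e : u x * (2 * (c + `|a|)) = c + `|a| + x - a.
    by rewrite uE; field; apply: lt0r_neq0; lra.
  have := ler_norm a; have := ler_norm (- a); rewrite normrN => a1 a2.
  by rewrite -(ler_pM2r k0) -(ler_pM2r k0 (u x)) e; apply/andP; lra.
have u2 x : (u x <= 2^-1) = (x <= a).
  by rewrite uE gerDl pmulr_lle0 ?invr_gt0// subr_le0.
have mu_ : measurable_fun [set: R] u.
  by apply: measurable_funD => //; exact: measurable_funM.
have mstep n : measurable_fun [set: R] (step_approx n \o u).
  rewrite /step_approx; apply: measurable_funX; apply: measurable_funB => //.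
  by apply: measurable_funM => //; apply: measurable_funX.
rewrite -Rintegral_indic//.
(* Outside [K] the polynomials are unbounded; multiplying by the indicator of [K] leaves the
   integrals unchanged and provides the bound 1 for bounded convergence. *)
rewrite (supp_Rintegral mu K _ _ _ (fun x => \1_(`]-oo, a]%classic) x * \1_K x))//;
  first last.
- by move=> x Kx; rewrite [\1_K x]indicE mem_set// mulr1.
- by apply: measurable_funM; exact: measurable_indic.
under eq_fun => n.
  rewrite (supp_Rintegral mu K _ _ _ (fun x => (step_approx n \o u) x * \1_K x))//;
    first last.
  - by move=> x Kx; rewrite [\1_K x]indicE mem_set// mulr1.
  - by apply: measurable_funM => //; exact: measurable_indic.
  over.
apply: bounded_convergence.
- by move=> n; apply: measurable_funM => //; exact: measurable_indic.
- by apply: measurable_funM; exact: measurable_indic.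
- move=> n x; rewrite indicE; have [/set_mem Kx|_] := boolP (x \in K); last first.
    by rewrite mulr0 normr0.
  by have /andP[q0 q1] := step_approx_bound n _ (u01 x Kx); rewrite mulr1 ger0_norm.
move=> x; rewrite !indicE; have [/set_mem Kx|_] := boolP (x \in K); last first.
  by under eq_fun do rewrite mulr0; rewrite mulr0; exact: cvg_cst.
under eq_fun do rewrite mulr1; rewrite mulr1.
have -> : (x \in `]-oo, a]%classic) = (u x <= 2^-1).
  by rewrite u2; apply/idP/idP; rewrite inE/= in_itv.
have [C Crate] := step_approx_rate _ (u01 x Kx).
apply/subr_cvg0; apply: norm_cvg0;
  apply: (@squeeze_cvgr _ _ _ _ (cst 0) (fun n => C * n.+1%:R^-1)).
- by apply: nearW => n; rewrite normr_ge0/= Crate.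
- exact: cvg_cst.
- by rewrite -(mulr0 C); apply: cvgMl_tmp; exact: cvg_harmonic.
Qed.

(** Equal moments mean equal integrals of polynomials, hence equal limits along the step
    polynomials, which are the measures of half-lines. The explicit polynomials take the place of
    Weierstrass approximation. *)
Lemma moments_unique mu nu (r : R) : 0 <= r -> nu (~` `[-r, r]) = 0%E ->
  (forall n, mu.-integrable setT (EFin \o (fun x : R => x ^+ n))) ->
  (forall n, Rintegral mu setT (fun x => x ^+ n) =
             Rintegral nu setT (fun x => x ^+ n)) ->
  forall S, measurable S -> mu S = nu S.
Proof.
move=> r0 nur imu E.
have muc := supp_of_moments mu nu r r0 nur imu E.
have inu n := supp_integrable_pow nu r n nur.
(* Comparing [nu] with itself widens its interval to the radius [r + 1] obtained for [mu], so that
   one affine map serves both measures. *)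
have nuc := supp_of_moments nu nu r r0 nur inu (fun=> erefl).
have c0 : 0 < r + 1 by lra.
have half a : mu `]-oo, a]%classic = nu `]-oo, a]%classic.
  pose p : {poly R} := (2^-1 - a / (2 * (r + 1 + `|a|)))%:P +
    (2 * (r + 1 + `|a|))^-1 *: 'X.
  pose u x : R := 2^-1 - a / (2 * (r + 1 + `|a|)) +
    (2 * (r + 1 + `|a|))^-1 * x.
  have cmu : Rintegral mu setT (step_approx n \o u) @[n --> \oo] -->
    fine (mu `]-oo, a]%classic) := half_line mu _ a c0 muc.
  have cnu : Rintegral nu setT (step_approx n \o u) @[n --> \oo] -->
    fine (nu `]-oo, a]%classic) := half_line nu _ a c0 nuc.
  have sE n x : step_approx n (u x) =
      ((1 - n.+1%:R^-1 *: p ^+ (2 * n.+1)) ^+ (4 ^ n.+1)).[x].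
    by rewrite /step_approx !(horner_exp, hornerE).
  have pE n : Rintegral mu setT (step_approx n \o u) =
              Rintegral nu setT (step_approx n \o u).
    pose q : {poly R} := (1 - n.+1%:R^-1 *: p ^+ (2 * n.+1)) ^+ (4 ^ n.+1).
    have -> : step_approx n \o u = fun x => \sum_(i < size q) q`_i * x ^+ i.
      by apply/funext => x /=; rewrite sE horner_coef.
    exact: moments_poly.
  have fE : fine (mu `]-oo, a]%classic) = fine (nu `]-oo, a]%classic).
    move: cmu; under eq_fun do rewrite pE.
    by move=> cmu; exact: (cvg_unique _ cmu cnu).
  rewrite -(@fineK _ (mu _)) ?fin_num_measure//.
  by rewrite fE fineK// fin_num_measure.
move=> S mS; apply: (@measure_unique _ R (measurableTypeR R)
  [set A | exists x : R, A = `]x, +oo[%classic]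
  (fun k => `]-k%:R, +oo[%classic) _ _ _ _ mu nu) => //.
- exact: (RGenOInfty.measurableE R).
- move=> _ _ [x ->] [y ->]; exists (Num.max x y).
  by apply/seteqP; split => z /=; rewrite !in_itv/= !andbT gt_max;
    [move=> [-> ->]|move/andP].
- by move=> i; exists (- i%:R).
- apply/seteqP; split => // x _; exists (Num.bound (`|x| : R)) => //=.
  rewrite in_itv/= andbT ltrNl (@le_lt_trans _ _ (`|x| : R))//.
    by rewrite -normrN ler_norm.
  exact: archi_boundP.
- move=> _ [x ->]; rewrite -setCitvl.
  have mI : measurable (`]-oo, x]%classic : set (measurableTypeR R)).
    exact: measurable_itv.
  apply: etrans (probability_setC mu mI) _.
  by apply: etrans (esym (probability_setC nu mI)); rewrite half.
- by move=> k; rewrite (le_lt_trans (probability_le1 mu _))// ltry.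
Qed.

End Moments.
(** * Operators in a von Neumann algebra *)

Section NormRe.
Context {R : realType} {V : normedModType R[i]}.
Implicit Types (u v l : V).

(** Norms of a space over [R[i]] are themselves elements of [R[i]]; taking the real part moves
    estimates and limits to the ordered field [R] without loss. *)
Definition rnorm v : R := complex.Re `|v|.

Lemma rnormE v : `|v| = (rnorm v)%:C.
Proof. by rewrite /rnorm RRe_real// normr_real. Qed.

Lemma rnorm_ge0 v : 0 <= rnorm v.
Proof. by rewrite -ler0c -rnormE. Qed.

Lemma rnormD u v : rnorm (u + v) <= rnorm u + rnorm v.
Proof. by rewrite -lecR raddfD/= -!rnormE ler_normD. Qed.

Lemma rnormN v : rnorm (- v) = rnorm v.
Proof. by rewrite /rnorm normrN. Qed.

Lemma rnorm0 : rnorm (0 : V) = 0.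
Proof. by rewrite /rnorm normr0. Qed.

Lemma rnorm_eq0 v : rnorm v = 0 -> v = 0.
Proof. by move=> v0; apply/normr0_eq0; rewrite rnormE v0. Qed.

Lemma cvg_rnorm (u_ : nat -> V) l :
  u_ n @[n --> \oo] --> l <-> rnorm (u_ n - l) @[n --> \oo] --> (0 : R).
Proof.
split=> [/cvgrPdist_lt ul|/cvgrPdist_lt ul].
  apply/cvgrPdist_lt => e e0; have e0' : 0 < e%:C by rewrite -[0]/(0%:C) ltcR.
  apply: filterS (ul _ e0') => n.
  by rewrite sub0r normrN ger0_norm ?rnorm_ge0// -normrN opprB rnormE ltcR.
apply/cvgrPdist_lt => e e0.
have [e' eE] : exists e' : R, e = e'%:C.
  by have /complex_realP := gtr0_real e0.
rewrite {}eE in e0 *; have e0' : 0 < e' by rewrite -ltcR.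
apply: filterS (ul _ e0') => n.
by rewrite sub0r normrN ger0_norm ?rnorm_ge0// -normrN opprB rnormE ltcR.
Qed.

Lemma cvg_rnorm_le (u_ : nat -> V) l (e_ : nat -> R) :
  (forall n, rnorm (u_ n - l) <= e_ n) -> e_ n @[n --> \oo] --> (0 : R) ->
  u_ n @[n --> \oo] --> l.
Proof.
move=> ue e0; apply/cvg_rnorm; apply: (@squeeze_cvgr _ _ _ _ (cst 0) e_) => //.
  by apply: nearW => n; rewrite rnorm_ge0 ue.
exact: cvg_cst.
Qed.

Lemma cvg_rnorm_norm (u_ : nat -> V) l :
  u_ n @[n --> \oo] --> l -> rnorm (u_ n) @[n --> \oo] --> rnorm l.
Proof.
move=> /cvg_rnorm ul; apply/subr_cvg0; apply: norm_cvg0.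
apply: (@squeeze_cvgr _ _ _ _ (cst 0) _ _ _ _ _ ul); last exact: cvg_cst.
apply: nearW => n; rewrite normr_ge0/= ler_norml.
have := rnormD (u_ n - l) l; rewrite subrK.
have := rnormD (l - u_ n) (u_ n); rewrite subrK -(opprB (u_ n) l) rnormN.
by lra.
Qed.

End NormRe.

Lemma cauchy_rnorm {R : realType} {V : completeNormedModType R[i]}
    (u_ : nat -> V) (e_ : nat -> R) :
  (forall m n, (m <= n)%N -> rnorm (u_ n - u_ m) <= e_ m) ->
  e_ n @[n --> \oo] --> (0 : R) -> cvg (u_ n @[n --> \oo]).
Proof.
move=> ue /cvgrPdist_lt e0; apply/cauchy_cvgP; apply: cauchy_exP => e e_gt0.
have [e' eE] : exists e' : R, e = e'%:C.
  by have /complex_realP := gtr0_real e_gt0.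
rewrite {}eE in e_gt0 *; have e0' : 0 < e' by rewrite -ltcR.
have [N _ Ne] := e0 _ e0'.
exists (u_ N); exists N => // n Nn; rewrite -ball_normE /= -normrN opprB rnormE ltcR.
apply: le_lt_trans (ue _ _ Nn) _.
have := Ne N (leqnn N); rewrite /= sub0r normrN; apply: le_lt_trans.
exact: ler_norm.
Qed.

Section Representation.
Context {R : realType} {A : vonNeumannAlgebra R}.
Implicit Types (a b : A) (v w : vn_space A).

(** The representation is only required to be linear in [a]. Linearity in the vector comes from the
    bicommutant, which consists of bounded operators and equals the range. *)
Lemma vn_rep_lin a : linear (vn_rep a).
Proof.
have [_ H] := vn_rep_range A.
have : commutant (commutant (range (@vn_rep _ A))) (vn_rep a).
  by rewrite H; exists a.
by case=> -[].
Qed.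

Lemma vn_rep_bounded a : exists2 K : R, 0 < K &
  forall v, rnorm (vn_rep a v) <= K * rnorm v.
Proof.
have [_ H] := vn_rep_range A.
have : commutant (commutant (range (@vn_rep _ A))) (vn_rep a).
  by rewrite H; exists a.
case=> -[_ [M MP]] _.
(* On the zero space [M] may be any complex number; [|M| + 1] is always real and positive. *)
have [K KE] : exists K : R, `|M| + 1 = K%:C.
  by have /complex_realP := @ger0_real _ (`|M| + 1) (addr_ge0 (normr_ge0 _) ler01).
have K0 : 0 < K.
  have : 0 < K%:C by rewrite -KE ltr_pwDr.
  by rewrite ltcE => /andP[].
exists K => // v; rewrite -lecR rmorphM/= -KE -!rnormE.
have M0 := le_trans (normr_ge0 _) (MP v).
apply: le_trans (MP v) _; rewrite -(ger0_norm M0) normrM normr_id.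
by rewrite ler_wpM2r// lerDl.
Qed.

Lemma vn_repD a b v : vn_rep (a + b) v = vn_rep a v + vn_rep b v.
Proof. by have := vn_rep_linear 1 a b v; rewrite !scale1r. Qed.

Lemma vn_rep0 v : vn_rep (0 : A) v = 0.
Proof.
have /eqP := vn_repD 0 0 v; rewrite addr0 -[X in X == _]addr0.
by move=> /eqP/addrI <-.
Qed.

Lemma vn_repZ c a v : vn_rep (c *: a) v = c *: vn_rep a v.
Proof. by have := vn_rep_linear c a 0 v; rewrite addr0 vn_rep0 addr0. Qed.

Lemma vn_repN a v : vn_rep (- a) v = - vn_rep a v.
Proof. by rewrite -scaleN1r vn_repZ scaleN1r. Qed.

Lemma vn_repB a b v : vn_rep (a - b) v = vn_rep a v - vn_rep b v.
Proof. by rewrite vn_repD vn_repN. Qed.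

Lemma vn_repM a b v : vn_rep (a * b) v = vn_rep a (vn_rep b v).
Proof. by rewrite vn_rep_mul. Qed.

Lemma vn_rep1 v : vn_rep (1 : A) v = v.
Proof. by rewrite vn_rep_one. Qed.

Lemma vn_repBr a v w : vn_rep a (v - w) = vn_rep a v - vn_rep a w.
Proof.
by have := vn_rep_lin a (-1) w v; rewrite !scaleN1r ![- _ + _]addrC.
Qed.

Lemma vn_rep_ext a b : (forall v, vn_rep a v = vn_rep b v) -> a = b.
Proof. by move=> ab; apply: vn_rep_inj; apply/funext. Qed.

Lemma cvg_vn_rep a (u_ : nat -> vn_space A) l :
  u_ n @[n --> \oo] --> l -> vn_rep a (u_ n) @[n --> \oo] --> vn_rep a l.
Proof.
move=> /cvg_rnorm ul; have [K _ KP] := vn_rep_bounded a.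
apply: (@cvg_rnorm_le _ _ _ _ (fun n => K * rnorm (u_ n - l))).
  by move=> n; rewrite -vn_repBr.
by rewrite -(mulr0 K); apply: cvgMl_tmp.
Qed.

(* The inverse operator commutes with the commutant, hence lies in the
   algebra by the bicommutant property. *)
Lemma unit_of_inverse_operator a (U : vn_space A -> vn_space A) (K : R) :
  (forall v, vn_rep a (U v) = v) -> (forall v, U (vn_rep a v) = v) ->
  (forall v, rnorm (U v) <= K * rnorm v) -> a \is a GRing.unit.
Proof.
move=> aU Ua UK; have [_ range_bicomm] := vn_rep_range A.
have : range (@vn_rep _ A) U.
  rewrite -range_bicomm; split.
    split; last first.
      by exists K%:C => v; rewrite !rnormE -rmorphM lecR.
    move=> c v w; rewrite -[in LHS](aU v) -[in LHS](aU w).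
    by rewrite -(vn_rep_lin a c (U v) (U w)) Ua.
  move=> W [_ Wcomm]; apply/funext => v /=.
  have Wa w : W (vn_rep a w) = vn_rep a (W w).
    by have /(congr1 (fun f => f w)) := Wcomm (vn_rep a) (ex_intro2 _ _ a I erefl).
  by rewrite -[in LHS](aU v) Wa Ua.
case=> u _ uU; apply/unitrP; exists u; split; apply: vn_rep_ext => v.
  by rewrite vn_repM uU Ua vn_rep1.
by rewrite vn_repM uU aU vn_rep1.
Qed.

(** The Neumann series is summed at each vector, by completeness of the Hilbert space. The resulting
    operator is a bounded two-sided inverse, and [unit_of_inverse_operator] brings it back into the
    algebra. *)
Lemma unit_1B a : (forall v, rnorm (vn_rep a v) <= 2^-1 * rnorm v) ->
  1 - a \is a GRing.unit.
Proof.
move=> a_half.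
pose s n : A := \sum_(k < n) a ^+ k.
have sE n : (1 - a) * s n = 1 - a ^+ n.
  elim: n => [|n IH]; first by rewrite /s big_ord0 mulr0 expr0 subrr.
  by rewrite /s big_ord_recr/= mulrDr IH mulrBl mul1r -exprS addrA subrK.
have sE' n : s n * (1 - a) = 1 - a ^+ n.
  rewrite -sE; apply: commrB; first exact: commr1.
  by apply: commr_sym; apply: commr_sum => i _; apply: commrX.
have pow n v : rnorm (vn_rep (a ^+ n) v) <= 2^-1 ^+ n * rnorm v.
  elim: n => [|n IH]; first by rewrite !expr0 vn_rep1 mul1r.
  by rewrite !exprS vn_repM -mulrA (le_trans (a_half _))// ler_wpM2l.
have halfn0 : 2^-1 ^+ n @[n --> \oo] --> (0 : R).
  by apply: cvg_expr; rewrite ger0_norm ?invr_ge0// invf_lt1// ltr1n.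
have halfn0v c : 2^-1 ^+ n * c @[n --> \oo] --> (0 : R).
  by rewrite -(mul0r c); apply: cvgMr_tmp.
(* The factor is the sum of [2^-j] for [m <= j < m + k]; in closed form it is stable under induction
   on [k]. It yields the Cauchy property and, for [m = 0], the bound 2 on the inverse. *)
have sdiff m k v : rnorm (vn_rep (s (m + k)%N) v - vn_rep (s m) v) <=
    (2 * 2^-1 ^+ m - 2 * 2^-1 ^+ (m + k)) * rnorm v.
  elim: k => [|k IH]; first by rewrite addn0 !subrr rnorm0 mul0r.
  rewrite addnS /s big_ord_recr/= -/(s _) vn_repD addrAC.
  apply: le_trans (rnormD _ _) _.
  apply: le_trans (lerD IH (pow _ _)) _; rewrite -mulrDl ler_wpM2r ?rnorm_ge0//.
  by rewrite exprS; lra.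
have s_cvg v : cvg (vn_rep (s n) v @[n --> \oo]).
  apply: (cauchy_rnorm _ (fun n => 2 * (2^-1 ^+ n * rnorm v))).
    move=> m n mn; rewrite -(subnKC mn); apply: le_trans (sdiff _ _ _) _.
    rewrite mulrA ler_wpM2r ?rnorm_ge0// gerBl mulr_ge0// exprn_ge0// invr_ge0//.
  by rewrite -(mulr0 2); apply: cvgMl_tmp.
pose U v : vn_space A := lim (vn_rep (s n) v @[n --> \oo]).
have UP v : vn_rep (s n) v @[n --> \oo] --> U v by exact: s_cvg.
have res v : vn_rep (1 - a ^+ n) v @[n --> \oo] --> v.
  apply: (@cvg_rnorm_le _ _ _ _ (fun n => 2^-1 ^+ n * rnorm v)) => // n.
  by rewrite vn_repB vn_rep1 addrAC subrr add0r rnormN.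
apply: (@unit_of_inverse_operator _ U 2).
- move=> v; apply: (@cvg_unique _ (@norm_hausdorff _ _) _ _ _ _ _ (res v)).
  by have := cvg_vn_rep (1 - a) _ _ (UP v); under eq_fun do rewrite -vn_repM sE.
- move=> v; apply: (@cvg_unique _ (@norm_hausdorff _ _) _ _ _ _ _ (res v)).
  by have := UP (vn_rep (1 - a) v); under eq_fun do rewrite -vn_repM sE'.
move=> v; have cv := cvg_rnorm_norm _ _ (UP v).
have := @limr_le _ _ _ _ (2 * rnorm v) _ (cvgP _ cv).
rewrite (cvg_lim _ cv)//; apply; apply: nearW => n.
have := sdiff 0%N n v; rewrite add0n /s big_ord0 vn_rep0 subr0 => /le_trans; apply.
by rewrite ler_wpM2r ?rnorm_ge0// expr0 mulr1 gerBl mulr_ge0// exprn_ge0// invr_ge0.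
Qed.

(** Factor [a + c b] as [a (1 + c a^-1 b)]: if [K] bounds [a^-1 b], then [|c| < 1/(2K)] puts the
    second factor within reach of [unit_1B]. The free direction [b] serves two purposes: [b = 1]
    gives closedness of the spectrum, and [a = -1], [b = X], [c = 1/x] gives its boundedness. *)
Lemma unit_near a b : a \is a GRing.unit ->
  exists2 e : R, 0 < e & forall c, `|c| < e%:C -> a + c *: b \is a GRing.unit.
Proof.
move=> ua; have [K K0 KP] := vn_rep_bounded (a^-1 * b).
exists (2 * K)^-1; first by rewrite invr_gt0 mulr_gt0.
move=> c cK; have -> : a + c *: b = a * (1 - (- c) *: (a^-1 * b)).
  by rewrite scaleNr opprK mulrDr mulr1 -scalerAr mulrA mulrV// mul1r.
rewrite unitrMl//; apply: unit_1B => v; rewrite vn_repZ.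
rewrite -lecR rmorphM/= -!rnormE normrZ normrN.
have [k kE] : exists k : R, `|c| = k%:C.
  by have /complex_realP := normr_real c.
rewrite kE ltcR in cK *; rewrite !rnormE -!rmorphM lecR.
have k0 : 0 <= k by rewrite -ler0c -kE.
apply: le_trans (ler_wpM2l k0 (KP v)) _; rewrite mulrA ler_wpM2r ?rnorm_ge0//.
rewrite -(ler_pM2l (ltr0n _ 2)) mulfV// mulrCA mulrA mulrAC -mulrA.
have : k * (2 * K) < 1 by rewrite -ltr_pdivlMr ?mulr_gt0// div1r.
by lra.
Qed.

Lemma real_spectrum_closed (X : A) : closed (real_spectrum X).
Proof.
rewrite -[real_spectrum X]setCK; apply: open_closedC.
rewrite openE => x /= /contrapT ux.
have [e e0 eP] := unit_near _ 1 ux.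
apply/nbhs_ballP; exists e => // y; rewrite /ball/= => xy.
apply.
have -> : y%:C%:A - X = x%:C%:A - X + (y - x)%:C *: (1 : A).
  by rewrite rmorphB/= scalerBl [RHS]addrC addrA subrK.
apply: eP; rewrite normc_def/= expr0n/= addr0 sqrtr_sqr ltcR distrC.
exact: xy.
Qed.

Lemma real_spectrum_bounded (X : A) : exists2 r : R, 0 <= r &
  forall x, real_spectrum X x -> `|x| <= r.
Proof.
have [e e0 eP] := unit_near (-1) X (unitrN1 _).
exists e^-1; first by rewrite invr_ge0 ltW.
move=> x xX; rewrite leNgt; apply/negP => xe; apply: xX.
have x0 : x != 0.
  by rewrite -normr_gt0; apply: lt_trans xe; rewrite invr_gt0.
have -> : x%:C%:A - X = (- x%:C) *: (-1 + (x%:C)^-1 *: X).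
  rewrite scalerDr scalerA mulNr mulfV ?scaleN1r ?scaleNr ?scalerN ?opprK//.
  by apply: contra x0 => /eqP[->].
have uE : -1 + (x%:C)^-1 *: X \is a GRing.unit.
  apply: eP; rewrite normfV normc_def/= expr0n/= addr0 sqrtr_sqr.
  rewrite -fmorphV ltcR -[e]invrK ltf_pV2// posrE ?invr_gt0//.
  by rewrite normr_gt0.
rewrite -mulr_algl unitrMl//.
apply/unitrP; exists ((- x%:C)^-1%:A).
have xn0 : - x%:C != 0 :> R[i] by rewrite oppr_eq0; apply: contra x0 => /eqP[->].
by rewrite -!scalerAl !mul1r !scalerA mulVf ?mulfV// scale1r.
Qed.

End Representation.
(** * Borel functional calculus *)

Definition cbounded_measurable {R : realType} (h : R -> R[i]) :=
  bounded_measurable (fun x => complex.Re (h x)) /\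
  bounded_measurable (fun x => complex.Im (h x)).

Section ComplexFunctions.
Context {R : realType}.
Implicit Types (f g : R -> R[i]) (h : R -> R).

Lemma normc_real (x : R) : `|x%:C| = `|x|%:C.
Proof. by rewrite normc_def/= expr0n/= addr0 sqrtr_sqr. Qed.

Lemma normc_ge_Im (w : R[i]) : `|complex.Im w|%:C <= `|w|.
Proof.
by rewrite normc_def lecR -sqrtr_sqr ler_wsqrtr// lerDr sqr_ge0.
Qed.

Lemma normc_le_ReIm (w : R[i]) :
  `|w| <= (`|complex.Re w| + `|complex.Im w|)%:C.
Proof.
rewrite normc_def lecR -[leRHS]ger0_norm ?addr_ge0// -sqrtr_sqr.
rewrite ler_wsqrtr// -(real_normK (num_real (complex.Re w))).
rewrite -(real_normK (num_real (complex.Im w))).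
have := normr_ge0 (complex.Re w); have := normr_ge0 (complex.Im w); nra.
Qed.

Lemma bounded_measurableD h h' : bounded_measurable h ->
  bounded_measurable h' -> bounded_measurable (fun x => h x + h' x).
Proof.
move=> bh bh'; have := bounded_measurable_lin 1 _ _ bh bh'.
by congr bounded_measurable; apply/funext => x; rewrite mul1r.
Qed.

Lemma bounded_measurableN h : bounded_measurable h ->
  bounded_measurable (fun x => - h x).
Proof.
move=> bh; have := bounded_measurableM _ _ (bounded_measurable_cst (-1)) bh.
by congr bounded_measurable; apply/funext => x; rewrite mulN1r.
Qed.

Lemma cbounded_measurable_cst c : cbounded_measurable (fun=> c : R[i]).
Proof. by split; exact: bounded_measurable_cst. Qed.

Lemma cbounded_measurable_real h : bounded_measurable h ->
  cbounded_measurable (fun x => (h x)%:C).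
Proof. by move=> bh; split => //; exact: bounded_measurable_cst. Qed.

Lemma cbounded_measurableD f g : cbounded_measurable f ->
  cbounded_measurable g -> cbounded_measurable (fun x => f x + g x).
Proof.
by move=> [rf jf] [rg jg]; split;
  [have := bounded_measurableD _ _ rf rg|have := bounded_measurableD _ _ jf jg];
  congr bounded_measurable; apply/funext => x; rewrite raddfD.
Qed.

Lemma cbounded_measurableM f g : cbounded_measurable f ->
  cbounded_measurable g -> cbounded_measurable (fun x => f x * g x).
Proof.
move=> [rf jf] [rg jg]; split.
  have := bounded_measurableD _ _ (bounded_measurableM _ _ rf rg)
    (bounded_measurableN _ (bounded_measurableM _ _ jf jg)).
  by congr bounded_measurable; apply/funext => x; case: (f x) (g x) => ? ? [].
have := bounded_measurableD _ _ (bounded_measurableM _ _ rf jg)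
  (bounded_measurableM _ _ jf rg).
by congr bounded_measurable; apply/funext => x; case: (f x) (g x) => ? ? [].
Qed.

Lemma cbounded_measurableZ c g : cbounded_measurable g ->
  cbounded_measurable (fun x => c * g x).
Proof. exact/cbounded_measurableM/cbounded_measurable_cst. Qed.

Lemma cbounded_measurable_conj f : cbounded_measurable f ->
  cbounded_measurable (fun x => (f x)^*).
Proof.
move=> [rf jf]; split.
  by move: rf; congr bounded_measurable; apply/funext => x; case: (f x).
move: (bounded_measurableN _ jf).
by congr bounded_measurable; apply/funext => x; case: (f x).
Qed.

Lemma cbounded_measurable_borel (D : set R) f : cbounded_measurable f ->
  bounded_borel D f.
Proof.
move=> [[mr [M rM]] [mj [N jN]]]; split.
  by split; exact: measurable_funTS.
exists (M + N)%:C => x _; apply: le_trans (normc_le_ReIm _) _.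
by rewrite lecR lerD.
Qed.

Lemma cbounded_measurable_extend0 (D : set R) f : measurable D ->
  bounded_borel D f -> cbounded_measurable (extend0 D f).
Proof.
move=> mD [[mr mj] [M fM]].
have bd (p : R[i] -> R) : p 0 = 0 -> (forall w, `|p w|%:C <= `|w|) ->
    measurable_fun D (fun x => p (f x)) ->
    bounded_measurable (fun x => p (extend0 D f x)).
  move=> p0 pw mp; have pE : (fun x => p (extend0 D f x)) = (p \o f) \_ D.
    by apply/funext => x; rewrite /extend0 /patch; case: ifP => // _; exact: p0.
  split; first by rewrite pE; apply/(measurable_restrictT _ mD).
  exists `|complex.Re M| => x; rewrite /extend0 /patch.
  case: ifP => [/set_mem Dx|_]; last by rewrite p0 normr0.
  have := le_trans (pw (f x)) (fM x Dx); rewrite lecE => /andP[_ /=] /le_trans.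
  by apply; exact: ler_norm.
by split; apply: bd => //; [exact: normc_ge_Re|exact: normc_ge_Im].
Qed.

End ComplexFunctions.

Section HilbertPositivity.
Context {R : realType} {A : vonNeumannAlgebra R}.
Implicit Types (a b : A) (v : vn_space A).

Lemma inner_sa a v : selfadjoint a ->
  inner (vn_space A) (vn_rep (a * a) v) v = (rnorm (vn_rep a v) ^+ 2)%:C.
Proof.
move=> sa; rewrite vn_repM vn_rep_star sa -inner_norm rnormE.
by rewrite rmorphXn.
Qed.

Lemma vn_nonneg_sqr a : selfadjoint a -> vn_nonneg (a * a).
Proof. by move=> sa v; rewrite inner_sa// ler0c sqr_ge0. Qed.

Lemma inner_star_mul a v :
  inner (vn_space A) (vn_rep (star a * a) v) v = (rnorm (vn_rep a v) ^+ 2)%:C.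
Proof.
have adj := vn_rep_star a v (vn_rep a v).
(* [vn_rep_star] moves [a] from the left argument to [star a] on the right; Hermitian symmetry is
   what allows it to be used with [star a] on the left. *)
have herm : inner (vn_space A) (vn_rep (star a) (vn_rep a v)) v =
    (inner (vn_space A) v (vn_rep (star a) (vn_rep a v)))^*.
  by rewrite [LHS]hermC expr0 mul1r.
by rewrite vn_repM herm -adj -inner_norm rnormE -rmorphXn conjc_real.
Qed.

Lemma innerBl (u w v : vn_space A) : inner (vn_space A) (u - w) v =
  inner (vn_space A) u v - inner (vn_space A) w v.
Proof. exact: linearBl. Qed.

End HilbertPositivity.

Section Calculus.
Context {R : realType} {A : vonNeumannAlgebra R}.
Variables (X : A) (calculus : (R -> R[i]) -> A).
Hypothesis calculusP : borel_functional_calculus X calculus.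
Local Notation D := (real_spectrum X).
Implicit Types (f g : R -> R[i]) (h : R -> R).

Definition real_calculus h := calculus (fun x => (h x)%:C).

Lemma measurable_real_spectrum : measurable D.
Proof. by apply: closed_measurable; exact: real_spectrum_closed. Qed.

Lemma calculus_lin c f g : cbounded_measurable f -> cbounded_measurable g ->
  calculus (fun x => c * f x + g x) = c *: calculus f + calculus g.
Proof.
case: calculusP => _ H _ _ _ bf bg.
by apply: H; exact: cbounded_measurable_borel.
Qed.

Lemma calculus_mul f g : cbounded_measurable f -> cbounded_measurable g ->
  calculus (fun x => f x * g x) = calculus f * calculus g.
Proof.
case: calculusP => _ _ H _ _ bf bg.
by apply: H; exact: cbounded_measurable_borel.
Qed.

Lemma calculus_conj f : cbounded_measurable f ->
  calculus (fun x => (f x)^*) = star (calculus f).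
Proof.
case: calculusP => _ _ _ H _ bf.
by apply: H; exact: cbounded_measurable_borel.
Qed.

Lemma calculus1 : calculus (fun=> 1) = 1.
Proof. by case: calculusP => -[]. Qed.

Lemma calculus_ext f g : bounded_borel D f -> bounded_borel D g ->
  (forall x, D x -> f x = g x) -> calculus f = calculus g.
Proof.
move=> bf bg fg; case: calculusP => _ _ _ _ H; case: (bf) => mf [M fM].
apply: vn_rep_ext => v.
have cv : vn_rep (calculus f) v @[_ --> \oo] --> vn_rep (calculus g) v.
  apply: (H (fun=> f) g M) => // x Dx; rewrite fg//; exact: cvg_cst.
by apply: (@cvg_unique _ (@norm_hausdorff _ _) _ _ _ _ _ cv); exact: cvg_cst.
Qed.

Lemma calculus0 : calculus (fun=> 0) = 0.
Proof.
have b0 := @cbounded_measurable_cst R 0.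
have := calculus_lin (-1) _ _ b0 b0.
by rewrite scaleN1r addNr mulr0 addr0.
Qed.

Lemma calculusZ c g : cbounded_measurable g ->
  calculus (fun x => c * g x) = c *: calculus g.
Proof.
move=> bg; have := calculus_lin c _ _ bg (cbounded_measurable_cst 0).
by rewrite calculus0 addr0 => <-; congr calculus; apply/funext => x; rewrite addr0.
Qed.

Lemma calculusD f g : cbounded_measurable f -> cbounded_measurable g ->
  calculus (fun x => f x + g x) = calculus f + calculus g.
Proof.
move=> bf bg; have := calculus_lin 1 _ _ bf bg.
by rewrite scale1r => <-; congr calculus; apply/funext => x; rewrite mul1r.
Qed.

Lemma calculusB f g : cbounded_measurable f -> cbounded_measurable g ->
  calculus (fun x => f x - g x) = calculus f - calculus g.
Proof.
move=> bf bg; rewrite -scaleN1r addrC -calculus_lin//.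
by congr calculus; apply/funext => x; rewrite mulN1r addrC.
Qed.

Lemma calculus_cst c : calculus (fun=> c) = c%:A.
Proof.
rewrite -calculus1 -calculusZ; last exact: cbounded_measurable_cst.
by congr calculus; apply/funext => x; rewrite mulr1.
Qed.

Lemma real_calculus_lin (c : R) h h' : bounded_measurable h ->
  bounded_measurable h' -> real_calculus (fun x => c * h x + h' x) =
  c%:C *: real_calculus h + real_calculus h'.
Proof.
move=> bh bh'; rewrite /real_calculus -calculus_lin;
  [|exact: cbounded_measurable_real|exact: cbounded_measurable_real].
by congr calculus; apply/funext => x; rewrite rmorphD rmorphM.
Qed.

Lemma real_calculus_sa h : bounded_measurable h ->
  selfadjoint (real_calculus h).
Proof.
move=> bh; rewrite /selfadjoint -calculus_conj; last exact: cbounded_measurable_real.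
by congr calculus; apply/funext => x; rewrite conjc_real.
Qed.

(** The square root of [h] is the source of all positivity: it makes [h(X)] a nonnegative operator
    and [phi (h(X))] a nonnegative number. *)
Lemma real_calculus_sqr h : bounded_measurable h -> (forall x, 0 <= h x) ->
  exists2 k, bounded_measurable k &
    real_calculus h = real_calculus k * real_calculus k.
Proof.
move=> [mh [M hM]] h0.
have bk : bounded_measurable (fun x => Num.sqrt (h x)).
  split.
    apply: (@measurableT_comp _ _ _ _ _ _ (@Num.sqrt R)) => //.
    by apply: continuous_measurable_fun; exact: sqrt_continuous.
  exists (Num.sqrt M) => x; rewrite ger0_norm ?sqrtr_ge0// ler_wsqrtr//.
  exact: le_trans (ler_norm _) (hM x).
exists (fun x => Num.sqrt (h x)) => //.
rewrite /real_calculus -calculus_mul; try exact: cbounded_measurable_real.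
by congr calculus; apply/funext => x; rewrite -rmorphM -expr2 sqr_sqrtr.
Qed.

Lemma real_calculus_nonneg h : bounded_measurable h -> (forall x, 0 <= h x) ->
  vn_nonneg (real_calculus h).
Proof.
move=> bh h0; have [k bk ->] := real_calculus_sqr h bh h0.
exact/vn_nonneg_sqr/real_calculus_sa.
Qed.

Lemma real_calculus_le h h' : bounded_measurable h -> bounded_measurable h' ->
  (forall x, h x <= h' x) -> vn_le (real_calculus h) (real_calculus h').
Proof.
move=> bh bh' hh'; rewrite /vn_le.
have -> : real_calculus h' - real_calculus h =
    real_calculus (fun x => -1 * h x + h' x).
  by rewrite real_calculus_lin// rmorphN1 scaleN1r addrC.
apply: real_calculus_nonneg; first exact: bounded_measurable_lin.
by move=> x; rewrite mulN1r addrC subr_ge0.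
Qed.

Lemma indicator_calculus_idem (S : set R) : measurable S ->
  real_calculus \1_S * real_calculus \1_S = real_calculus \1_S.
Proof.
move=> mS; have bS := bounded_measurable_indic _ mS.
rewrite /real_calculus -calculus_mul; try exact: cbounded_measurable_real.
congr calculus; apply/funext => x; rewrite -rmorphM indicE.
by case: (x \in S); rewrite ?mulr1 ?mulr0.
Qed.

Lemma inner_indicator_calculus (S : set R) v : measurable S ->
  inner (vn_space A) (vn_rep (real_calculus \1_S) v) v =
  (rnorm (vn_rep (real_calculus \1_S) v) ^+ 2)%:C.
Proof.
move=> mS; rewrite -[in LHS]indicator_calculus_idem// inner_sa//.
exact/real_calculus_sa/bounded_measurable_indic.
Qed.

Lemma indicator_calculus_cvg (S_ : nat -> set R) v :
  (forall n, measurable (S_ n)) -> (forall m n, (m <= n)%N -> S_ m `<=` S_ n) ->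
  vn_rep (real_calculus \1_(S_ n)) v @[n --> \oo] -->
  vn_rep (real_calculus \1_(\bigcup_n S_ n)) v.
Proof.
move=> mS ndS; case: calculusP => _ _ _ _ H.
have bi (S : set R) : measurable S ->
    bounded_borel D (fun x => (\1_S x : R)%:C).
  move=> mS'; apply: cbounded_measurable_borel; apply: cbounded_measurable_real.
  exact: bounded_measurable_indic.
apply: (H (fun n x => (\1_(S_ n) x)%:C) _ 1).
- move=> n; split; first exact: (bi _ (mS n)).1.
  by move=> x _; rewrite normc_real indicE ger0_norm// lecR lern1 leq_b1.
- exact/bi/bigcupT_measurable.
move=> x Dx; have [[n _ Sx]|nSx] := pselect ((\bigcup_n S_ n) x); last first.
  rewrite [X in _ --> X](_ : _ = 0); last first.
    by rewrite indicE memNset.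
  rewrite (_ : (fun n => _) = (fun=> 0)); first exact: cvg_cst.
  by apply/funext => n; rewrite indicE memNset// => Sx; apply: nSx; exists n.
rewrite [X in _ --> X](_ : _ = 1); last first.
  by rewrite indicE mem_set//; exists n.
apply: (@cvg_near_cst _ _ _ _ _); exists n => // m /= nm.
by rewrite indicE mem_set//; exact: ndS Sx.
Qed.

(** Links the strong continuity of the calculus to [normal]. If [b] dominates the projections [P_n],
    then [<b v, v> >= |P_n v|^2], and strong convergence preserves this bound in the limit. *)
Lemma indicator_calculus_lub (S_ : nat -> set R) :
  (forall n, measurable (S_ n)) -> (forall m n, (m <= n)%N -> S_ m `<=` S_ n) ->
  vn_lub (range (fun n => real_calculus \1_(S_ n)))
    (real_calculus \1_(\bigcup_n S_ n)).
Proof.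
move=> mS ndS; set S := \bigcup_n S_ n.
have mU : measurable S by exact: bigcupT_measurable.
split=> [_ [n _ <-]|b bP v].
  apply: real_calculus_le; try exact: bounded_measurable_indic.
  move=> x; rewrite !indicE ler_nat; have [/set_mem Sx|//] := boolP (x \in S_ n).
  by rewrite mem_set//; exists n.
have bn n : (rnorm (vn_rep (real_calculus \1_(S_ n)) v) ^+ 2)%:C <=
    inner (vn_space A) (vn_rep b v) v.
  have := bP _ (ex_intro2 _ _ n I erefl) v.
  by rewrite vn_repB innerBl inner_indicator_calculus// subr_ge0.
rewrite vn_repB innerBl inner_indicator_calculus// subr_ge0.
move: (inner _ _ _) bn => w bn.
(* The order of [R[i]] also compares imaginary parts; the bound for [n = 0] already shows that [w]
   is real, and only real parts remain. *)
rewrite lecE; have := bn 0%N; rewrite lecE => /andP[-> _] /=.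
have bn' n : rnorm (vn_rep (real_calculus \1_(S_ n)) v) ^+ 2 <= complex.Re w.
  by have := bn n; rewrite lecE => /andP[].
have /cvg_rnorm_norm cv := indicator_calculus_cvg S_ v mS ndS.
have cv2 : rnorm (vn_rep (real_calculus \1_(S_ n)) v) *
    rnorm (vn_rep (real_calculus \1_(S_ n)) v) @[n --> \oo] -->
    rnorm (vn_rep (real_calculus \1_S) v) *
    rnorm (vn_rep (real_calculus \1_S) v) by exact: cvgM.
have := @limr_le _ _ _ _ (complex.Re w) _ (cvgP _ cv2).
rewrite (cvg_lim _ cv2)// -expr2; apply; apply: nearW => n.
by rewrite /= -expr2.
Qed.

End Calculus.

(** * The distribution of a self-adjoint element as its spectral measure *)

Section Distribution.
Context {R : realType} {A : vonNeumannAlgebra R}.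
Variables (phi : {scalar A}) (phi_state : state phi) (phi_normal : normal phi).
Variables (X : A) (calculus : (R -> R[i]) -> A).
Hypothesis calculusP : borel_functional_calculus X calculus.
Local Notation D := (real_spectrum X).
Local Notation rcalc := (real_calculus calculus).
Implicit Types (f g : R -> R[i]) (h : R -> R).

Let J h : R := complex.Re (phi (rcalc h)).

Let phi_ge0 h : bounded_measurable h -> (forall x, 0 <= h x) ->
  0 <= phi (rcalc h).
Proof.
move=> bh h0; have [k bk ->] := real_calculus_sqr X calculus calculusP h bh h0.
rewrite -{1}(real_calculus_sa X calculus calculusP k bk).
by case: phi_state => _; apply.
Qed.

Let phi_lin (c : R) h h' : bounded_measurable h -> bounded_measurable h' ->
  phi (rcalc (fun x => c * h x + h' x)) = c%:C * phi (rcalc h) + phi (rcalc h').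
Proof. by move=> bh bh'; rewrite (real_calculus_lin X)// linearP. Qed.

Let phi_one : phi (rcalc (cst 1)) = 1.
Proof. by rewrite /real_calculus (calculus1 X)//; case: phi_state. Qed.

Let J_lin (c : R) h h' : bounded_measurable h -> bounded_measurable h' ->
  J (fun x => c * h x + h' x) = c * J h + J h'.
Proof.
move=> bh bh'; rewrite /J phi_lin// raddfD/=; congr (_ + _).
by case: (phi _) => ? ? /=; rewrite mul0r subr0.
Qed.

(** If [M] bounds [|h|], then [M + h] is nonnegative and so has a real, nonnegative image under
    [phi]; subtracting the real number [M] keeps it real. *)
Let phi_real h : bounded_measurable h -> phi (rcalc h) = (J h)%:C.
Proof.
move=> bh; have [_ [M hM]] := bh.
have b1 := bounded_measurable_cst (1 : R).
have ge0 : 0 <= phi (rcalc (fun x => M * cst 1 x + h x)).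
  apply: phi_ge0; first exact: bounded_measurable_lin.
  move=> x; rewrite /= mulr1 addrC -lerBlDr sub0r.
  by have := hM x; rewrite ler_norml => /andP[].
have := ger0_Im ge0; rewrite phi_lin// phi_one mulr1 raddfD/= add0r /J.
by case: (phi _) => ? ? /= ->.
Qed.

Let J_ge0 h : bounded_measurable h -> (forall x, 0 <= h x) -> 0 <= J h.
Proof. by move=> bh h0; rewrite -ler0c -phi_real// phi_ge0. Qed.

Let J_one : J (cst 1) = 1.
Proof. by rewrite /J phi_one. Qed.

Let J_cont (S : nat -> set R) : (forall n, measurable (S n)) ->
  (forall m n, (m <= n)%N -> S m `<=` S n) ->
  J \1_(S n) @[n --> \oo] --> J \1_(\bigcup_n S n).
Proof.
move=> mS ndS; have mU : measurable (\bigcup_n S n) by exact: bigcupT_measurable.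
have bS n := bounded_measurable_indic _ (mS n).
have bU := bounded_measurable_indic _ mU.
have ndI m n : (m <= n)%N -> forall x, (\1_(S m) x : R) <= \1_(S n) x.
  move=> mn x; rewrite !indicE ler_nat.
  by have [/set_mem/(ndS _ _ mn) Sx|//] := boolP (x \in S m); rewrite mem_set.
have ndJ : nondecreasing_seq (fun n => J \1_(S n)).
  by move=> m n mn; apply: functional_mono => //; exact: ndI.
have JU n : J \1_(S n) <= J \1_(\bigcup_n S n).
  apply: functional_mono => // x; rewrite !indicE ler_nat.
  by have [/set_mem Sx|//] := boolP (x \in S n); rewrite mem_set//; exists n.
have ubJ : has_ubound (range (fun n => J \1_(S n))).
  by exists (J \1_(\bigcup_n S n)) => _ [n _ <-].
have := nondecreasing_cvgn ndJ ubJ; set s := sup _ => cvs.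
suff -> : J \1_(\bigcup_n S n) = s by [].
apply/eqP; rewrite eq_le; apply/andP; split; last first.
  apply: ge_sup; first by exists (J \1_(S 0%N)), 0%N.
  by move=> _ [n _ <-].
(* Normality places the value at the union below every upper bound of the values at the [S n], in
   particular below their limit [s]. *)
have [_] : supremums (phi @` range (fun n => rcalc \1_(S n)))
    (phi (rcalc \1_(\bigcup_n S n))).
  apply: phi_normal.
  - split; first by exists (rcalc \1_(S 0%N)), 0%N.
    move=> _ _ [m _ <-] [n _ <-]; exists (rcalc \1_(S (maxn m n))).
      by exists (maxn m n).
    split; apply: (real_calculus_le X) => //; apply: ndI;
      [exact: leq_maxl|exact: leq_maxr].
  - by move=> _ [n _ <-]; exact: (real_calculus_sa X).
  - exact: (real_calculus_sa X).
  - exact: (indicator_calculus_lub X).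
move=> /(_ s%:C); rewrite phi_real// lecR; apply.
move=> _ [_ [n _ <-] <-]; rewrite phi_real// lecR.
by apply: sup_upper_bound; [split => //; exists (J \1_(S 0%N)), 0%N|exists n].
Qed.

Let spectral_measure : exists nu : probability (measurableTypeR R) R,
  forall h, bounded_measurable h -> J h = Rintegral nu setT h.
Proof. exact: positive_functional_integral J_lin J_ge0 J_one J_cont. Qed.

(** The identity is unbounded on the line; this truncation is bounded and has the same image under
    the calculus, namely [X]. *)
Definition spectral_id (x : R) : R := x * \1_D x.

Lemma bounded_spectral_id : bounded_measurable spectral_id.
Proof.
have [r r0 rP] := real_spectrum_bounded X.
have mD := measurable_real_spectrum X.
split; first by apply: measurable_funM => //; exact: measurable_indic.
exists r => x; rewrite /spectral_id indicE.
have [/set_mem Dx|_] := boolP (x \in D); first by rewrite mulr1 rP.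
by rewrite mulr0 normr0.
Qed.

Lemma real_calculus_id : rcalc spectral_id = X.
Proof.
have [r r0 rP] := real_spectrum_bounded X.
case: (calculusP) => -[_ calcX] _ _ _ _.
rewrite -[RHS]calcX /real_calculus; apply: (calculus_ext X) => //.
- exact/cbounded_measurable_borel/cbounded_measurable_real/bounded_spectral_id.
- split; first by split => /=; [exact: measurable_id|exact: measurable_cst].
  by exists r%:C => x Dx; rewrite normc_real lecR rP.
- by move=> x Dx; rewrite /spectral_id indicE mem_set// mulr1.
Qed.

Let bounded_spectral_idX n : bounded_measurable (fun x => spectral_id x ^+ n).
Proof.
elim: n => [|n IH]; first exact: bounded_measurable_cst.
have := bounded_measurableM _ _ bounded_spectral_id IH.
by congr bounded_measurable; apply/funext => x; rewrite exprS.
Qed.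

Let real_calculus_idX n : rcalc (fun x => spectral_id x ^+ n) = X ^+ n.
Proof.
elim: n => [|n IH]; first by rewrite expr0 /real_calculus (calculus1 X).
rewrite exprS -IH -{1}real_calculus_id /real_calculus -(calculus_mul X)//.
- by congr calculus; apply/funext => x; rewrite exprS rmorphM.
- exact/cbounded_measurable_real/bounded_spectral_id.
- exact/cbounded_measurable_real/bounded_spectral_idX.
Qed.

Variable mu : probability (measurableTypeR R) R.
Hypothesis mu_distr : is_distribution phi X mu.

Lemma distribution_calculus :
  mu (~` D) = 0%E /\
  forall h, bounded_measurable h -> phi (rcalc h) = (Rintegral mu setT h)%:C.
Proof.
have [nu nuP] := spectral_measure.
have [r r0 rP] := real_spectrum_bounded X.
have mD := measurable_real_spectrum X.
have mDc : measurable (~` D) by exact: measurableC.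
(* The indicator of the complement agrees with 0 on the spectrum, so the calculus sends it to 0. *)
have nuD : nu (~` D) = 0%E.
  have : Rintegral nu setT \1_(~` D) = 0.
    rewrite -nuP; last exact: bounded_measurable_indic.
    rewrite /J /real_calculus (calculus_ext X calculus calculusP _ (fun=> 0)).
    - by rewrite (calculus0 X)// raddf0.
    - apply: cbounded_measurable_borel; apply: cbounded_measurable_real.
      exact: bounded_measurable_indic.
    - exact/cbounded_measurable_borel/cbounded_measurable_cst.
    - by move=> x Dx; rewrite indicE memNset//; exact.
  rewrite Rintegral_indic// => nu0.
  by rewrite -(@fineK _ (nu (~` D))) ?nu0// fin_num_measure.
have nur : nu (~` `[-r, r]) = 0%E.
  apply: (@subset_measure0 _ _ _ nu _ (~` D)) => //.
  - by apply: measurableC; exact: measurable_itv.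
  - by apply: subsetC => x /rP; rewrite ler_norml /= in_itv.
have ReX n : (fun x : R => complex.Re (x%:C ^+ n)) = (fun x => x ^+ n).
  by apply/funext => x; rewrite -rmorphXn.
have mX n : measurable_fun [set: R] (fun x : R => x ^+ n).
  exact: exprn_measurable.
have muint n : mu.-integrable setT (EFin \o (fun x : R => x ^+ n)).
  by have [[+ _] _] := mu_distr n; rewrite -ReX.
have moments n : Rintegral mu setT (fun x => x ^+ n) =
    Rintegral nu setT (fun x => x ^+ n).
  have [_ /(congr1 (@complex.Re R)) /=] := mu_distr n; rewrite ReX => ->.
  rewrite -real_calculus_idX -/(J _) nuP//.
  apply: (supp_Rintegral nu D) => //; first exact: (bounded_spectral_idX n).1.
  by move=> x Dx; rewrite /spectral_id indicE mem_set// mulr1.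
have munu := moments_unique mu nu r r0 nur muint moments.
split; first by rewrite munu.
move=> h bh; rewrite phi_real// nuP//; congr (_%:C); rewrite /Rintegral; congr fine.
by apply/esym; apply: eq_measure_integral => S mS _; exact: munu.
Qed.

Lemma distribution_calculus_complex f : cbounded_measurable f ->
  phi (calculus f) = cintegral mu f.
Proof.
move=> [rf jf]; have [_ H] := distribution_calculus.
have -> : calculus f = 'i *: rcalc (fun x => complex.Im (f x)) +
    rcalc (fun x => complex.Re (f x)).
  rewrite /real_calculus -(calculus_lin X)//; try exact: cbounded_measurable_real.
  by congr calculus; apply/funext => x; rewrite addrC -complexE.
rewrite linearP !H// /cintegral [RHS]complexE/=.
by rewrite addrC.
Qed.

End Distribution.

(** * The inverse of an invertible [g(X)] as a bounded function of [X] *)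

Section Resolvent.
Context {R : realType} {A : vonNeumannAlgebra R}.
Variables (X : A) (calculus : (R -> R[i]) -> A).
Hypothesis calculusP : borel_functional_calculus X calculus.
Implicit Types (g : R -> R[i]).

Definition sqrnorm g (x : R) : R :=
  complex.Re (g x) ^+ 2 + complex.Im (g x) ^+ 2.

Lemma sqrnormE g x : (sqrnorm g x)%:C = (g x)^* * g x.
Proof. by rewrite /sqrnorm add_Re2_Im2 sqr_normc mulrC. Qed.

Lemma sqrnorm_ge0 g x : 0 <= sqrnorm g x.
Proof. by rewrite addr_ge0// sqr_ge0. Qed.

Lemma bounded_sqrnorm g : cbounded_measurable g -> bounded_measurable (sqrnorm g).
Proof.
move=> [rg jg]; apply: bounded_measurableD.
  by have := bounded_measurableM _ _ rg rg; under eq_fun do rewrite -expr2.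
by have := bounded_measurableM _ _ jg jg; under eq_fun do rewrite -expr2.
Qed.

(* On the spectral subspace of [{|g|^2 < e}] the operator [g(X)] has norm at
   most [sqrt e], which is incompatible with a bounded inverse unless that
   subspace is trivial. *)
Lemma unit_calculus_gap g : cbounded_measurable g ->
  calculus g \is a GRing.unit -> exists2 e : R, 0 < e &
    measurable [set x | sqrnorm g x < e] /\
    real_calculus calculus \1_[set x | sqrnorm g x < e] = 0.
Proof.
move=> bg ug; have [K K0 KP] := vn_rep_bounded (calculus g)^-1.
(* With [P] the projection [1_S(X)], [|P v|^2 <= K^2 |g(X) P v|^2 <= K^2 e |P v|^2]; this [e] makes
   the last factor 1/2, which forces [P v = 0]. *)
pose e := (2 * K ^+ 2)^-1.
have e0 : 0 < e by rewrite invr_gt0 mulr_gt0// exprn_gt0.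
exists e => //; set S := [set x | _].
have bq := bounded_sqrnorm g bg.
have mS : measurable S.
  have := bq.1 measurableT `]-oo, e[%classic (measurable_itv _).
  by rewrite setTI; congr measurable; apply/seteqP; split => x /=; rewrite in_itv.
split=> //; have bS := bounded_measurable_indic _ mS.
apply: vn_rep_ext => v; rewrite vn_rep0; apply: rnorm_eq0.
set P := real_calculus calculus \1_S.
pose g1 x := g x * (\1_S x)%:C.
have bS' : cbounded_measurable (fun x => (\1_S x : R)%:C).
  exact: cbounded_measurable_real.
have bg1 : cbounded_measurable g1 by exact: cbounded_measurableM.
have gP : calculus g * P = calculus g1.
  by rewrite -(calculus_mul X).
pose q x := sqrnorm g x * \1_S x.
have bqS : bounded_measurable q by exact: bounded_measurableM.
have g1g1 : star (calculus g1) * calculus g1 = real_calculus calculus q.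
  rewrite -(calculus_conj X)// -(calculus_mul X)//; last first.
    exact: cbounded_measurable_conj.
  rewrite /real_calculus; congr calculus; apply/funext => x.
  transitivity ((sqrnorm g x)%:C * (\1_S x : R)%:C); last by rewrite -rmorphM.
  rewrite sqrnormE /g1 indicE.
  by case: (x \in S); rewrite ?(mulr1n, mulr0n, rmorph1, rmorph0, mulr1, mulr0).
(* The pointwise inequality [|g|^2 1_S <= e 1_S], turned into an operator inequality and tested at
   [v]. *)
have small : rnorm (vn_rep (calculus g1) v) ^+ 2 <= e * rnorm (vn_rep P v) ^+ 2.
  have beS : bounded_measurable (fun x => e * \1_S x).
    exact: (bounded_measurableM _ _ (bounded_measurable_cst e) bS).
  have := real_calculus_le X calculus calculusP q (fun x => e * \1_S x) bqS beS _ v.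
  have -> : real_calculus calculus (fun x => e * \1_S x) = e%:C *: P.
    rewrite /P /real_calculus -(calculusZ X)//.
    by congr calculus; apply/funext => x; rewrite rmorphM.
  rewrite vn_repB innerBl -g1g1 inner_star_mul vn_repZ.
  rewrite [X in X - _](_ : _ = (e * rnorm (vn_rep P v) ^+ 2)%:C); last first.
    transitivity (e%:C * (rnorm (vn_rep P v) ^+ 2)%:C); last by rewrite -rmorphM.
    have := inner_indicator_calculus X calculus calculusP S v mS.
    by rewrite -/P => <-; exact: linearZl_LR.
  rewrite subr_ge0 lecR; apply => x; rewrite /q indicE.
  have [/set_mem/ltW Sx|_] := boolP (x \in S); first by rewrite !mulr1.
  by rewrite !mulr0.
have : rnorm (vn_rep P v) <= K * rnorm (vn_rep (calculus g1) v).
  by have := KP (vn_rep (calculus g1) v); rewrite -gP -vn_repM mulrA mulVr// mul1r.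
move: (rnorm_ge0 (vn_rep P v)) (rnorm_ge0 (vn_rep (calculus g1) v)) small.
move: (rnorm (vn_rep P v)) (rnorm (vn_rep (calculus g1) v)) => p w p0 w0 wp pw.
have : p ^+ 2 <= 2^-1 * p ^+ 2.
  apply: (@le_trans _ _ (K ^+ 2 * w ^+ 2)).
    by rewrite -exprMn lerXn2r ?nnegrE// mulr_ge0// ltW.
  apply: (@le_trans _ _ (K ^+ 2 * (e * p ^+ 2))).
    by rewrite ler_wpM2l// sqr_ge0.
  rewrite (_ : K ^+ 2 * (e * p ^+ 2) = 2^-1 * p ^+ 2)// /e; field.
  by rewrite gt_eqF.
move=> p2; have p20 := sqr_ge0 p; have {p2 p20} : p ^+ 2 <= 0 by lra.
by rewrite le_eqVlt ltNge sqr_ge0 orbF sqrf_eq0 => /eqP.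
Qed.

(** Off the gap set [S] the function [1/g], that is the conjugate of [g] over [|g|^2], is bounded.
    Cut off to 0 on [S], it satisfies [g' g = 1 - 1_S], which the calculus maps to 1. This left
    inverse is the inverse because [g(X)] is a unit. *)
Lemma calculus_inverse g : cbounded_measurable g ->
  calculus g \is a GRing.unit -> exists (S : set R) (g' : R -> R[i]),
    [/\ measurable S, real_calculus calculus \1_S = 0,
      cbounded_measurable g', (calculus g)^-1 = calculus g' &
      forall x, ~ S x -> g' x = (g x)^-1].
Proof.
move=> bg ug; have [e e0 [mS PS]] := unit_calculus_gap g bg ug.
set S := [set x | _] in mS PS.
have bq := bounded_sqrnorm g bg.
(* The maximum changes nothing off [S] and bounds the reciprocal by [e^-1] everywhere. *)
pose rho x := (Num.max e (sqrnorm g x))^-1.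
have max0 x : 0 < Num.max e (sqrnorm g x) by rewrite lt_max e0.
have brho : bounded_measurable rho.
  split; last first.
    exists e^-1 => x; have rho0 : 0 <= rho x by rewrite invr_ge0 ltW.
    rewrite ger0_norm// /rho lef_pV2 ?posrE//.
    by rewrite le_max lexx.
  rewrite (_ : rho = (@powR R ^~ (-1)) \o (fun x => Num.max e (sqrnorm g x))).
    apply: measurableT_comp; first exact: measurable_powR.
    by apply: measurable_maxr => //; exact: bq.1.
  by apply/funext => x /=; rewrite powR_inv1 ?ltW.
have mSc : measurable (~` S) by exact: measurableC.
pose k x := rho x * \1_(~` S) x.
have bk : cbounded_measurable (fun x => (k x)%:C).
  apply: cbounded_measurable_real; apply: bounded_measurableM => //.
  exact: bounded_measurable_indic.
pose g' x := (k x)%:C * (g x)^*.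
have bg' : cbounded_measurable g'.
  exact/(cbounded_measurableM _ _ bk)/cbounded_measurable_conj.
have sq_ge x : ~ S x -> Num.max e (sqrnorm g x) = sqrnorm g x.
  by move=> /negP; rewrite -leNgt => /max_idPr.
have g'g : calculus g' * calculus g = 1.
  rewrite -(calculus_mul X)//.
  have -> : (fun x => g' x * g x) = (fun x => 1 - (\1_S x)%:C).
    apply/funext => x; rewrite /g' -mulrA -sqrnormE /k !indicE in_setC.
    have [Sx|/negP Sx] := boolP (x \in S); first by rewrite mulr0 mul0r subrr.
    have {}Sx : ~ S x by move=> xS; apply: Sx; exact: mem_set.
    rewrite /= mulr1 -rmorphM /rho sq_ge// mulVf.
      by rewrite rmorph1 mulr0n rmorph0 subr0.
    by rewrite -(sq_ge x Sx) gt_eqF.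
  rewrite (calculusB X)// ?(calculus1 X)// -/(real_calculus calculus _) ?PS ?subr0//.
    exact: cbounded_measurable_cst.
  exact/cbounded_measurable_real/bounded_measurable_indic.
exists S, g'; split => //.
  by rewrite -[RHS]mulr1 -(mulrV ug) mulrA g'g mul1r.
move=> x Sx; rewrite /g' /k indicE mem_set// mulr1 /rho sq_ge//.
rewrite [X in X * _](_ : _ = ((sqrnorm g x)%:C)^-1); last exact: fmorphV.
rewrite sqrnormE.
have g0 : g x != 0.
  apply/eqP => gx0; have := max0 x; rewrite sq_ge// /sqrnorm gx0/=.
  by rewrite expr0n/= addr0 ltxx.
by rewrite invfM mulrAC mulVf ?mul1r// conjc_eq0.
Qed.

End Resolvent.

(** * The integral formula for the Cauchy transform *)

Theorem corollary1p4 (R : realType) (A : vonNeumannAlgebra R)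
    (phi : {scalar A}) (phi_state : state phi) (phi_faithful : faithful phi)
    (phi_normal : normal phi) (phi_tracial : tracial phi)
    (X Y : A) (X_sa : selfadjoint X) (Y_sa : selfadjoint Y)
    (XY_free : free_variables phi X Y)
    (mu : probability (measurableTypeR R) R)
    (mu_distr : is_distribution phi X mu)
    (calculus : (R -> R[i]) -> A)
    (calculusP : borel_functional_calculus X calculus)
    (f : R -> R[i]) (f_borel : bounded_borel (real_spectrum X) f)
    (fX_neq0 : calculus f != 0)
    (E : {linear A -> A})
    (E_cond : conditional_expectation phi (vn_generated [set X]) E)
    (delta : R[i] -> R[i])
    (deltaP : forall z : R[i], 0 < complex.Im z ->
      let fX := calculus f in
      z%:A - X - delta z *: (fX * star fX) \is a GRing.unit /\
      E ((z%:A - X - fX * Y * star fX)^-1) =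
        (z%:A - X - delta z *: (fX * star fX))^-1) :
  forall z : R[i], 0 < complex.Im z ->
    let fX := calculus f in
    let h x :=
      1 / (z - x%:C - delta z * `|extend0 (real_spectrum X) f x| ^+ 2) in
    cintegrable mu h /\
    cauchy_transform phi (X + fX * Y * star fX) z = cintegral mu h.
Proof.
move=> z z_gt0 fX h.
have [uW EW] := deltaP z z_gt0.
pose D := real_spectrum X.
have mD : measurable D := measurable_real_spectrum X.
pose f0 := extend0 D f.
have bf0 : cbounded_measurable f0 := cbounded_measurable_extend0 D f mD f_borel.
have fXE : fX = calculus f0.
  apply: (calculus_ext X calculus calculusP) => //.
    exact: cbounded_measurable_borel.
  by move=> x Dx; rewrite /f0 /extend0 /patch mem_set.
have bc := @cbounded_measurable_cst R z.
have bid := cbounded_measurable_real _ (bounded_spectral_id X).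
have bff := cbounded_measurableM _ _ bf0 (cbounded_measurable_conj _ bf0).
(* A bounded function on the whole line that equals the denominator of [h] on the spectrum, written
   as sums and multiples to match the rules of the calculus. *)
pose g x := z + -1 * (spectral_id X x)%:C + - delta z * (f0 x * (f0 x)^*).
have bg1 : cbounded_measurable (fun x => z + -1 * (spectral_id X x)%:C).
  exact/(cbounded_measurableD _ _ bc)/cbounded_measurableZ.
have bg : cbounded_measurable g.
  exact/(cbounded_measurableD _ _ bg1)/cbounded_measurableZ.
have gE : calculus g = z%:A - X - delta z *: (fX * star fX).
  rewrite (calculusD X calculus calculusP)//; last exact: cbounded_measurableZ.
  rewrite (calculusD X calculus calculusP)//; last exact: cbounded_measurableZ.
  rewrite !(calculusZ X calculus calculusP)// (calculus_mul X calculus calculusP)//;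
    last exact: cbounded_measurable_conj.
  rewrite (calculus_conj X calculus calculusP)// (calculus_cst X calculus calculusP).
  rewrite -/(real_calculus calculus (spectral_id X)) real_calculus_id//.
  by rewrite scaleN1r scaleNr -fXE.
have [S [g' [mS PS bg' invE g'E]]] : exists (S : set R) (g' : R -> R[i]),
    [/\ measurable S, real_calculus calculus \1_S = 0,
      cbounded_measurable g', (calculus g)^-1 = calculus g' &
      forall x, ~ S x -> g' x = (g x)^-1].
  by apply: (calculus_inverse X); rewrite // gE.
have [muD phiE] := distribution_calculus phi phi_state phi_normal X calculus
  calculusP mu mu_distr.
have muS : mu S = 0%E.
  have := phiE _ (bounded_measurable_indic _ mS).
  rewrite PS raddf0 Rintegral_indic// => -[/esym mu0].
  by rewrite -(@fineK _ (mu S)) ?mu0// fin_num_measure.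
(* On this set of full measure [spectral_id] is the identity and [g'] is [1/g], so [h] and [g']
   coincide. *)
pose K := D `\` S.
have mK : measurable K by exact: measurableD.
have muK : mu (~` K) = 0%E.
  rewrite setCD; apply: null_set_setU => //; exact: measurableC.
have hg' x : K x -> h x = g' x.
  move=> [Dx Sx]; rewrite g'E// /h div1r; congr (_^-1).
  rewrite /g /spectral_id indicE mem_set// mulr1 mulN1r mulNr.
  by rewrite -/D -/f0 sqr_normc.
(* Agreement with [g'] on [K] does not make [h] measurable on the line, so measurability is derived
   from the parts of its true denominator [w]; [mp] treats both parts at once. *)
pose w x := z - x%:C - delta z * (f0 x * (f0 x)^*).
have mp (p : R[i] -> R) : (forall u v, p (u + v) = p u + p v) ->
    (forall u, p (- u) = - p u) ->
    measurable_fun [set: R] (fun x : R => p x%:C) ->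
    measurable_fun [set: R] (fun x => p (delta z * (f0 x * (f0 x)^*))) ->
    measurable_fun [set: R] (fun x => p (w x)).
  move=> pD pN px pf; rewrite (_ : (fun x => p (w x)) =
    (fun x => p z - p x%:C - p (delta z * (f0 x * (f0 x)^*)))); last first.
    by apply/funext => x; rewrite /w !pD !pN.
  by apply: measurable_funB => //; apply: measurable_funB.
have bdff := cbounded_measurableZ (delta z) _ bff.
have mRe : measurable_fun [set: R] (fun x => complex.Re (w x)).
  by apply: mp; [move=> u v; exact: raddfD|move=> u; exact: raddfN|
    exact: measurable_id|exact: bdff.1.1].
have mIm : measurable_fun [set: R] (fun x => complex.Im (w x)).
  by apply: mp; [move=> u v; exact: raddfD|move=> u; exact: raddfN|
    exact: measurable_cst|exact: bdff.2.1].
have minv : measurable_fun [set: R] (fun x => (sqrnorm w x)^-1).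
  rewrite (_ : (fun x => _) = (@powR R ^~ (-1)) \o sqrnorm w).
    apply: measurableT_comp; first exact: measurable_powR.
    by apply: measurable_funD; exact: measurable_funX.
  by apply/funext => x /=; rewrite powR_inv1// sqrnorm_ge0.
(* This holds also where [w x = 0]: both sides are then 0, since the inverse of 0 is 0. *)
have hE x : h x = complex.Re (w x) * (sqrnorm w x)^-1 +i*
    (- complex.Im (w x) * (sqrnorm w x)^-1).
  rewrite /h div1r -/f0 sqr_normc -/(w x) /sqrnorm.
  by case: (w x) => a b; rewrite mulNr.
have mhRe : measurable_fun [set: R] (fun x => complex.Re (h x)).
  under eq_fun do rewrite hE /=; exact: measurable_funM.
have mhIm : measurable_fun [set: R] (fun x => complex.Im (h x)).
  under eq_fun do rewrite hE /=.
  by apply: measurable_funM => //; exact: measurable_funN.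
split.
  split.
    apply: (supp_integrable mu K mK muK _ _ mhRe bg'.1.1).
      by move=> x Kx; rewrite hg'.
    exact: (bounded_measurable_integrable mu _ bg'.1).
  apply: (supp_integrable mu K mK muK _ _ mhIm bg'.2.1).
    by move=> x Kx; rewrite hg'.
  exact: (bounded_measurable_integrable mu _ bg'.2).
have -> : cintegral mu h = cintegral mu g'.
  rewrite /cintegral (supp_Rintegral mu K mK muK _ _ mhRe bg'.1.1).
    rewrite (supp_Rintegral mu K mK muK _ _ mhIm bg'.2.1)//.
    by move=> x Kx; rewrite hg'.
  by move=> x Kx; rewrite hg'.
have [_ _ _ _ phiEc] := E_cond.
rewrite /cauchy_transform opprD addrA -phiEc EW -gE invE.
exact: (distribution_calculus_complex phi phi_state phi_normal X calculus
  calculusP mu mu_distr).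
Qed.
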